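(* Assume $\diamondsuit_{\omega_1}(S)$, where $S$ is a stationary set of limit ordinals $<\omega_1$. Let $p$ be a prime. Then there exists an $\aleph_1$-separable abelian group $A$ of cardinality $\aleph_1$ such that $\Gamma(A)=\tilde S$, $A$ is of quotient type $\mathbb{Q}^{(p)}$, and $A$ has no coherent unbounded system of projections.
   Context: All groups are abelian. $\diamondsuit_{\omega_1}(S)$ is Jensen's diamond principle on $S$: there is a sequence $\langle X_\delta:\delta\in S\rangle$ with $X_\delta\subseteq\delta$ such that for every $X\subseteq\omega_1$ the set $\{\delta\in S: X\cap\delta=X_\delta\}$ is stationary. An abelian group $A$ is $\aleph_1$-separable if every countable subset of $A$ is contained in a countable free direct summand of $A$. A filtration of an $\aleph_1$-separable group $A$ of cardinality $\aleph_1$ is a continuous increasing chain $\{A_\nu:\nu<\omega_1\}$ of subgroups with $A_0=0$, $A=\bigcup_{\nu<\omega_1}A_\nu$, and each $A_{\nu+1}$ a countable free direct summand of $A$. Given a filtration, let $E=\{\nu<\omega_1:\nu \text{ a limit ordinal and } A_{\nu+1}/A_\nu \text{ is not free}\}$; $\Gamma(A)=\tilde E$ is the equivalence class of $E$ modulo the closed unbounded filter on $\omega_1$ (this does not depend on the filtration), and $\tilde S$ denotes the class of $S$. $A$ has quotient type $H$ if $A$ has a filtration such that $A_{\nu+1}/A_\nu\cong H$ for every $\nu$ with $A_{\nu+1}/A_\nu$ not free. $\mathbb{Q}^{(p)}$ is the subgroup of $\mathbb{Q}$ of rationals whose denominators are powers of $p$. A projection is a homomorphism $\pi:A\to A$ with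 $\pi\circ\pi=\pi$. A coherent unbounded system of projections of $A$ is a family $\{\pi_i:i\in I\}$ of projections $\pi_i$ of $A$ with image $H_i$ a countable free group, such that every countable subset of $A$ is contained in some $H_i$, and such that whenever $H_j\subseteq H_i$ we have $\pi_j\circ\pi_i=\pi_j$. *)

(* Defs.v *)
From HB Require Import structures.
From mathcomp Require Import all_boot all_order all_algebra.
From mathcomp Require Import boolp classical_sets functions cardinality wochoice.
Set Implicit Arguments.
Unset Strict Implicit.
Unset Printing Implicit Defensive.
Import Order.TTheory GRing.Theory Num.Theory.
Local Open Scope classical_set_scope.
Local Open Scope order_scope.

(* The ordinal omega_1 is given up to isomorphism, as an uncountable well-order
   all of whose proper initial segments are countable; its elements play the
   role of the ordinals below omega_1, and an ordinal delta is identified with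
   the initial segment `below delta`. *)
Definition is_omega1 (d : Order.disp_t) (W : orderType d) : Prop :=
  [/\ well_order (<=%O : rel W),
      forall a : W, countable [set b : W | b < a]
    & ~ countable [set: W]].

Section Omega1.
Context (d : Order.disp_t) (W : orderType d).
Implicit Types (a b c : W) (C S T : set W).

Definition below a : set W := [set b | b < a].

Definition is_zero a : Prop := forall b, a <= b.

Definition is_succ a b : Prop := a < b /\ forall c, a < c -> b <= c.

(* 0 is not a limit ordinal. *)
Definition is_limit a : Prop :=
  ~ is_zero a /\ forall b, b < a -> exists c, b < c < a.

Definition unbounded_set C : Prop := forall a, exists2 b, C b & a < b.

Definition closed_set C : Prop :=
  forall a, is_limit a ->
    (forall b, b < a -> exists2 c, C c & b < c < a) -> C a.

Definition club C : Prop := closed_set C /\ unbounded_set C.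

Definition stationary S : Prop := forall C, club C -> S `&` C !=set0.

(* Only the values X delta with delta in S matter. *)
Definition diamond S : Prop :=
  exists X : W -> set W,
    (forall delta, S delta -> X delta `<=` below delta) /\
    (forall Y : set W,
       stationary [set delta | S delta /\ Y `&` below delta = X delta]).

(* Equality modulo the club filter. *)
Definition club_equiv S T : Prop :=
  exists2 C, club C & S `&` C = T `&` C.

Definition club_class S : set (set W) := [set T | club_equiv T S].

End Omega1.

Local Open Scope ring_scope.

Record subgroup (A : zmodType) (B : zmodClosed A) : Type :=
  Subgroup { sgval : A; _ : sgval \in B }.

HB.instance Definition _ (A : zmodType) (B : zmodClosed A) :=
  [isSub for @sgval A B].
HB.instance Definition _ (A : zmodType) (B : zmodClosed A) :=
  [Choice of subgroup B by <:].
HB.instance Definition _ (A : zmodType) (B : zmodClosed A) :=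
  [SubChoice_isSubZmodule of subgroup B by <:].

Section Quotient.
Context (A : zmodType) (B C : zmodClosed A).

Definition restrict : {pred subgroup B} := [pred x | \val x \in C].

Fact restrict_zmod_closed : zmod_closed restrict.
Proof.
split=> [|x y]; first exact: (rpred0 C).
exact: (@rpredB _ C (\val x) (\val y)).
Qed.

HB.instance Definition _ :=
  GRing.isZmodClosed.Build (subgroup B) restrict restrict_zmod_closed.

(* The quotient group B / C, where C is meant to be contained in B. *)
Definition quotient_group : zmodType := Quotient.quot restrict.

End Quotient.

Section Groups.
Implicit Types (A G H : zmodType).

Definition isomorphic G H : Prop := exists f : {additive G -> H}, bijective f.

Definition is_basis G (X : set G) : Prop :=
  (forall (s : seq G) (c : G -> int), uniq s -> [set` s] `<=` X ->
     \sum_(x <- s) x *~ c x = 0 -> forall x, x \in s -> c x = 0) /\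
  (forall g : G, exists (s : seq G) (c : G -> int),
     [set` s] `<=` X /\ g = \sum_(x <- s) x *~ c x).

Definition free_group G : Prop := exists X : set G, is_basis X.

Definition direct_summand A (B : zmodClosed A) : Prop :=
  exists C : zmodClosed A,
    (forall x, x \in B -> x \in C -> x = 0) /\
    (forall x, exists b c, [/\ b \in B, c \in C & x = b + c]).

Definition countable_free_summand A (B : zmodClosed A) : Prop :=
  [/\ countable [set` B], free_group (subgroup B) & direct_summand B].

Definition aleph1_separable A : Prop :=
  forall X : set A, countable X ->
    exists B : zmodClosed A, X `<=` [set` B] /\ countable_free_summand B.

(* A family of projections pi_i with image H_i. *)
Record coherent_unbounded_system A (I : Type)
    (pi : I -> {additive A -> A}) (H : I -> zmodClosed A) : Prop := {
  system_proj : forall i, pi i \o pi i =1 pi i;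
  system_image : forall i, range (pi i) = [set` H i];
  system_countable : forall i, countable [set` H i];
  system_free : forall i, free_group (subgroup (H i));
  system_unbounded : forall X : set A, countable X ->
    exists i, X `<=` [set` H i];
  system_coherent : forall i j, [set` H j] `<=` [set` H i] ->
    pi j \o pi i =1 pi j
}.

Definition has_coherent_unbounded_system A : Prop :=
  exists (I : Type) (pi : I -> {additive A -> A}) (H : I -> zmodClosed A),
    coherent_unbounded_system pi H.

End Groups.

Section Filtrations.
Context (d : Order.disp_t) (W : orderType d) (A : zmodType).
Implicit Types F : W -> zmodClosed A.

Record filtration F : Prop := {
  filtration_increasing : forall a b : W, (a <= b)%O -> [set` F a] `<=` [set` F b];
  filtration_continuous : forall a : W, is_limit a ->
    [set` F a] = \bigcup_(b in below a) [set` F b];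
  filtration_zero : forall a : W, is_zero a -> [set` F a] = [set 0];
  filtration_union : \bigcup_(a in [set: W]) [set` F a] = [set: A];
  filtration_succ : forall a b : W, is_succ a b -> countable_free_summand (F b)
}.

(* A successor exists and is unique in omega_1. *)
Definition nonfree_at F (a : W) : Prop :=
  exists2 b, is_succ a b & ~ free_group (quotient_group (F b) (F a)).

Definition nonfree_limits F : set W := [set a | is_limit a /\ nonfree_at F a].

(* The class, modulo the club filter, of the set `nonfree_limits F` for a
   filtration F of A. As that class does not depend on F, the union below is
   the union of copies of a single class; without a filtration it is empty. *)
Definition Gamma : set (set W) :=
  \bigcup_(F in filtration) club_class (nonfree_limits F).

Definition has_quotient_type (H : zmodType) : Prop :=
  exists2 F, filtration F &
    forall a b : W, is_succ a b ->
      ~ free_group (quotient_group (F b) (F a)) ->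
      isomorphic (quotient_group (F b) (F a)) H.

End Filtrations.

Arguments Gamma {d} W A.
Arguments has_quotient_type {d} W A H.

Section Qp.
Context (p : nat).

(* The rationals whose denominator in lowest terms is a power of the prime p. *)
Definition Qp_pred : {pred rat} := [pred x : rat | (p.-nat `|denq x|)%N].

Fact Qp_zmod_closed : zmod_closed Qp_pred.
Proof.
split=> // x y; rewrite !inE => xp yp.
set n := numq x * denq y - numq y * denq x; set m := denq x * denq y.
have m0 : m != 0 by rewrite mulf_neq0 ?denq_neq0.
have E : x - y = n%:~R / m%:~R.
  rewrite -{1}[x]divq_num_den -{1}[y]divq_num_den -mulNr.
  by rewrite addf_div ?intr_eq0 ?denq_neq0 // rmorphB !rmorphM /= mulNr.
have dv : (`|denq (x - y)| %| `|m|)%N.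
  rewrite E; clearbody n m; case: divqP m0 => [_|k z _ _]; first by rewrite eqxx.
  by rewrite abszM dvdn_mull.
by apply: pnat_dvd dv _; rewrite abszM pnatM xp.
Qed.

HB.instance Definition _ := GRing.isZmodClosed.Build rat Qp_pred Qp_zmod_closed.

Definition Qp : zmodType := subgroup Qp_pred.

End Qp.

(* Main.v *)
Require Import Defs.
From HB Require Import structures.
From mathcomp Require Import all_boot all_order all_algebra.
From mathcomp Require Import boolp classical_sets functions cardinality wochoice.
Set Implicit Arguments.
Unset Strict Implicit.
Unset Printing Implicit Defensive.
Import Order.TTheory GRing.Theory Num.Theory.
Local Open Scope classical_set_scope.
Local Open Scope ring_scope.

(** A is built inside the rational vector space D on generators [unit b], where
    b = (nu, k) has level nu.  At a level nu outside S all the [unit (nu, k)] belong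
    to A; at delta in S one adjoins elements [zgen delta n] with
      p^n zgen(delta, n) = unit (delta, 0) + sum_(j < n) p^j y(delta, j),
    where the y(delta, j) are integral combinations of generators of levels < delta.
    The part F_a of A supported at levels < a gives the filtration.

    Each mu comes with a retraction [retract mu] of the integral vectors onto the
    levels <= mu, and these retractions are far from coherent: for finitely many mu
    their values can be prescribed independently.  As each of them kills almost all
    y(delta, j), it extends to A, which makes the F_(mu+1) direct summands, while
    fresh coordinates in the y(delta, j) bound denominators modulo F_alpha for
    alpha outside S, which makes these quotients free.

    In a coherent unbounded system, let s_i be a minimal finite set of levels such
    that pi_i kills every integral vector killed by the retractions indexed by s_i.
    Independence of the retractions and coherence make s_i increase with H_i, so if
    all the s_i existed, some s_i would be the largest, and pi_j would kill a fixed
    nonzero vector for all j above i, even those with that vector in H_j.  Hence for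
    some i there are integral vectors killed by any given finitely many retractions
    but not by pi_i.  Diamond guesses this pi_i on A_delta, and y(delta, _) is built
    from such vectors so that the p-adic limit of - sum_j p^j pi_i(y(delta, j)) is
    not in A_delta; this leaves no value for pi_i at zgen(delta, 0). *)

(** * The ordinal omega_1 *)

Lemma countable_seq (T : eqType) (X : set T) :
  countable X -> countable [set s : seq T | [set` s] `<=` X].
Proof.
move=> /countable_injP[f finj]; apply/countable_injP.
exists (fun s => pickle (map f s)) => s t /set_mem/= sX /set_mem/= tX.
move=> /(pcan_inj (@pickleK _)); elim: s t sX tX => [|x s IH] [|y t] //= sX tX [fxy st].
congr (_ :: _).
  by apply: finj => //; rewrite inE; [apply: sX|apply: tX]; rewrite /= mem_head.
by apply: IH => // z zs; [apply: sX|apply: tX]; rewrite /= inE; apply/orP; right.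
Qed.

Section Omega1Theory.
Local Open Scope order_scope.
Context (d : Order.disp_t) (W : orderType d) (hW : is_omega1 W).
Implicit Types (a b c : W).

Lemma exists_least (P : set W) : P !=set0 -> exists2 a, P a & forall b, P b -> a <= b.
Proof.
case: hW => wo _ _ [a Pa]; have [|z [[zP zmin] _]] := wo [pred x | `[< P x >]].
  by exists a; apply/asboolP.
exists z; first by move: zP => /asboolP.
by move=> b Pb; apply: zmin; apply/asboolP.
Qed.

Lemma omega1_ind (P : W -> Prop) :
  (forall a, (forall b, b < a -> P b) -> P a) -> forall a, P a.
Proof.
move=> IH a; apply: contrapT => na.
have [|z nz zmin] := @exists_least [set x | ~ P x]; first by exists a.
by apply: nz; apply: IH => b bz; apply: contrapT => /zmin; rewrite leNgt bz.
Qed.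

Lemma omega1_wf : well_founded (fun a b : W => a < b).
Proof. by apply: omega1_ind => a IH; constructor. Qed.

Lemma countable_below a : countable (below a).
Proof. by case: hW => _ h _; exact: h. Qed.

Lemma countable_le a : countable [set b | b <= a].
Proof.
have /countable_injP[f finj] := countable_below a.
apply/countable_injP; exists (fun b => if b == a then 0 else (f b).+1)%N.
move=> b c /set_mem/= ba /set_mem/= ca.
case: (eqVneq b a) => [->|nb]; case: (eqVneq c a) => [->|nc] // [] /finj; apply.
  by rewrite inE /below /= lt_neqAle nb.
by rewrite inE /below /= lt_neqAle nc.
Qed.

(** Otherwise W would be a union of countably many countable initial segments. *)
Lemma countable_bounded (C : set W) : countable C -> exists a, forall c, C c -> c < a.
Proof.
move=> cC; apply: contrapT => nb; case: hW => _ _; apply.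
rewrite (_ : [set: W] = \bigcup_(c in C) [set b | b <= c]).
  by apply: bigcup_countable => // c _; exact: countable_le.
apply/seteqP; split=> // a _; apply: contrapT => na; apply: nb; exists a => c Cc.
by rewrite ltNge; apply/negP => ac; apply: na; exists c.
Qed.

Lemma omega1_point : exists a : W, True.
Proof. by case: (countable_bounded (@countable0 W)) => a _; exists a. Qed.

Lemma exists_gt a : exists b, a < b.
Proof.
have [|b h] := @countable_bounded [set a]; first exact: finite_set_countable.
by exists b; apply: h.
Qed.

Lemma exists_succ a : exists b, is_succ a b.
Proof.
have [|b ab bmin] := @exists_least [set b | a < b]; first by case: (exists_gt a) => b; exists b.
by exists b.
Qed.

Lemma succ_lt a b c : is_succ a b -> (c < b) = (c <= a).
Proof.
move=> [ab h]; apply/idP/idP => [cb|ca]; last exact: le_lt_trans ab.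
by rewrite leNgt; apply/negP => /h; rewrite leNgt cb.
Qed.

Lemma succ_not_limit a b : is_succ a b -> ~ is_limit b.
Proof.
by move=> [ab h] [_ /(_ a ab)[c /andP[/h bc cb]]]; rewrite ltNge bc in cb.
Qed.

Lemma limit_succ a b c : is_limit c -> is_succ a b -> a < c -> b < c.
Proof. by move=> [_ lc] sab /lc [e /andP[ae ec]]; apply: le_lt_trans ec; apply: sab.2. Qed.

Lemma exists_zero : exists a : W, is_zero a.
Proof.
have [|a _ h] := @exists_least setT; first by case: omega1_point => a _; exists a.
by exists a => b; apply: h.
Qed.

Lemma limit_gt0 a : is_limit a -> exists b, b < a.
Proof.
move=> [na _]; apply: contrapT => h; apply: na => b; rewrite leNgt; apply/negP => ba.
by apply: h; exists b.
Qed.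

Lemma limit_seq_bounded a (s : seq W) : is_limit a -> (forall b, b \in s -> b < a) ->
  exists2 c, c < a & forall b, b \in s -> b < c.
Proof.
move=> la; elim: s => [|b s IH] h; first by case: (limit_gt0 la) => c; exists c.
have [c ca hc] := IH (fun x xs => h x (mem_behead (s := b :: s) xs)).
have [|e /andP[me ea]] := la.2 (Order.max b c); first by rewrite gt_max h ?mem_head.
exists e => // x; rewrite inE => /orP[/eqP->|/hc xc]; apply: le_lt_trans me.
  by rewrite le_max lexx.
by rewrite le_max (ltW xc) orbT.
Qed.

(** Recursion with choice. The relation [P] is stated on total functions; by the first hypothesis it
    depends only on the values below [a], so a partial function may be extended by [t0]. *)
Lemma omega1_rec (T : Type) (t0 : T) (P : W -> (W -> T) -> T -> Prop) :
  (forall a f g t, (forall b, b < a -> f b = g b) -> P a f t -> P a g t) ->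
  (forall a f, (forall b, b < a -> P b f (f b)) -> exists t, P a f t) ->
  exists f, forall a, P a f (f a).
Proof.
move=> Ploc Pex.
pose ext a (g : forall b, b < a -> T) b :=
  if pselect (b < a) is left h then g b h else t0.
pose F a (g : forall b, b < a -> T) := if pselect (exists t, P a (ext a g) t) is left h then projT1 (cid h) else t0.
pose f := Fix omega1_wf (fun _ => T) F.
have fE a : f a = F a (fun b _ => f b).
  rewrite /f Wf.Fix_eq // => x g g' gg'; congr (F x _).
  by apply: functional_extensionality_dep => b; apply: functional_extensionality_dep.
have extE a b : b < a -> ext a (fun b _ => f b) b = f b.
  by move=> ba; rewrite /ext; case: pselect.
exists f; apply: omega1_ind => a IH; rewrite fE /F; case: pselect => [h|[]].
  by case: cid => t ht /=; apply: Ploc ht => b; exact: extE.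
apply: Pex => b ba; rewrite extE //; apply: Ploc (IH b ba) => c cb.
by rewrite extE // (lt_trans cb).
Qed.

Lemma countable_images (f : W -> W) a : exists2 b, a < b & forall c, c <= a -> f c < b.
Proof.
have [|b h] := @countable_bounded (f @` [set c | c <= a]).
  by apply: sub_countable (card_image_le _ _) _; exact: countable_le.
have [c ac] := exists_gt (Order.max a b).
exists c => [|e ea]; first by apply: le_lt_trans ac; rewrite le_max lexx.
apply: lt_trans (h _ _) (le_lt_trans _ ac); first by exists e.
by rewrite le_max lexx orbT.
Qed.

Lemma seq_sup (u : nat -> W) : (forall n, u n < u n.+1) ->
  exists l, [/\ is_limit l, forall n, u n < l & forall b, b < l -> exists n, b < u n].
Proof.
move=> uS; have [|l ul lmin] := @exists_least [set l | forall n, u n < l].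
  have [|a h] := @countable_bounded (range u); last by exists a => n; apply: h; exists n.
  exact: sub_countable (card_image_le _ _) _.
have lub b : b < l -> exists n, b < u n.
  move=> bl; apply: contrapT => nb; have := lmin b; rewrite leNgt bl => /(_ _)/negP; apply=> //.
  move=> n; apply: lt_le_trans (uS n) _; rewrite leNgt; apply/negP => h; apply: nb; by exists n.+1.
exists l; split=> //; split=> [z|b /lub[n bn]]; last by exists (u n); rewrite bn ul.
by have := z (u 0%N); rewrite leNgt ul.
Qed.

(** For unboundedness, iterate a function that bounds [f] on initial segments; the supremum of the
    iterates is closed under [f]. *)
Lemma closure_club (f : W -> W) :
  club [set a | is_limit a /\ forall b, b < a -> f b < a].
Proof.
split.
  move=> a la h; split=> // b ba; have [c [_ cf] /andP[bc ca]] := h _ ba.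
  exact: lt_trans (cf b bc) ca.
have [g hg] := choice (fun a => let: ex_intro2 b h1 h2 := countable_images f a in
  ex_intro (fun b => a < b /\ forall c, c <= a -> f c < b) b (conj h1 h2)).
move=> a; have [l [ll ul lub]] := @seq_sup (fun n => iter n g a) (fun n => (hg _).1).
exists l; last exact: ul 0%N.
split=> // b /lub[n bn]; apply: lt_trans (ul n.+1); apply: (hg _).2; exact: ltW.
Qed.

Lemma clubI (C D : set W) : club C -> club D -> club (C `&` D).
Proof.
move=> [cC uC] [cD uD]; split.
  move=> a la h; split; [apply: cC|apply: cD] => // b /h[c [c1 c2] bc]; by exists c.
have [f hf] := choice (fun a => let: ex_intro2 b h1 h2 := uC a in
  ex_intro (fun b => C b /\ a < b) b (conj h1 h2)).
have [g hg] := choice (fun a => let: ex_intro2 b h1 h2 := uD a in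
  ex_intro (fun b => D b /\ a < b) b (conj h1 h2)).
(* A limit closed under both functions is a limit of elements of [C] and of elements of [D]. *)
move=> a; have [_ /(_ a)[l [ll lf] al]] := closure_club (fun a => Order.max (f a) (g a)).
exists l => //; split; [apply: cC|apply: cD] => // b /lf; rewrite gt_max => /andP[fl gl].
  by exists (f b); [apply: (hf b).1|rewrite (hf b).2].
by exists (g b); [apply: (hg b).1|rewrite (hg b).2].
Qed.

Lemma club_equiv_trans (S T U : set W) : club_equiv S T -> club_equiv T U -> club_equiv S U.
Proof.
move=> [C cC h] [D cD h']; exists (C `&` D); first exact: clubI.
by rewrite meetA h meetAC h' meetAC -meetA.
Qed.

(** Send [v] to the least level containing it and to its number in an enumeration of that level;
    each level is allotted an omega-sequence in W disjoint from those of all smaller levels. *)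
Lemma omega1_injection (V : Type) (L : W -> set V) :
  (forall a, countable (L a)) -> (forall v, exists a, L a v) ->
  exists k : V -> W, injective k.
Proof.
move=> cL eL; have [a0 _] := omega1_point.
have [lv hlv] := choice (fun v => let: ex_intro2 a h1 h2 := exists_least (eL v) in
  ex_intro (fun a => L a v /\ forall b, L b v -> a <= b) a (conj h1 h2)).
have cinj a : exists i : V -> nat, {in L a &, injective i} by apply/countable_injP.
have [i hi] := choice cinj.
have [s hs] := choice exists_gt.
have smono c : {homo (fun n => iter n s c) : m n / (m < n)%N >-> m < n}.
  by apply: homo_ltn => //; exact: lt_trans.
have [||f hf] := @omega1_rec (nat -> W) (fun => a0) (fun a f t => injective t /\
  forall b, b < a -> forall m n, t m <> f b n).
- by move=> a f g t fg [ti ht]; split=> // b ba; rewrite -fg //; exact: ht.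
- move=> a f _; have [|c hc] := @countable_bounded (\bigcup_(b in below a) range (f b)).
    apply: bigcup_countable => [|b _]; first exact: countable_below.
    exact: sub_countable (card_image_le _ _) _.
  exists (fun n => iter n s c); split=> [m n|b ba m n mn].
    by case: (ltngtP m n) => // /(smono c) /[swap] ->; rewrite ltxx.
  have : c <= f b n by rewrite -mn; case: m {mn} => // m; apply/ltW/(smono c 0%N).
  by rewrite leNgt hc //; exists b => //; exists n.
exists (fun v => f (lv v) (i (lv v) v)) => v w.
case: (ltgtP (lv v) (lv w)) => [h|h|h].
- by move=> /esym e; have := (hf (lv w)).2 _ h _ _ e.
- by move=> e; have := (hf (lv v)).2 _ h _ _ e.
- by rewrite -h => /(hf _).1/hi; apply; rewrite inE; [|rewrite h]; exact: (hlv _).1.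
Qed.

End Omega1Theory.

(** * Finitely supported rational vectors *)

Section FinSupp.
Context (B : choiceType).

Definition finsupp_pred : {pred B -> rat^o} :=
  [pred x | `[< exists s : seq B, forall b, b \notin s -> x b = 0 >]].

Fact finsupp_submod_closed : submod_closed finsupp_pred.
Proof.
split; first by apply/asboolP; exists [::].
move=> a x y /asboolP[s hs] /asboolP[t ht]; apply/asboolP; exists (s ++ t) => b.
by rewrite mem_cat negb_or => /andP[/hs xb /ht yb]; rewrite !fctE xb yb scaler0 addr0.
Qed.

HB.instance Definition _ :=
  GRing.isSubmodClosed.Build rat (B -> rat^o) finsupp_pred finsupp_submod_closed.

Record fsf := Fsf { fsval : B -> rat^o; _ : fsval \in finsupp_pred }.

HB.instance Definition _ := [isSub for fsval].
HB.instance Definition _ := [Choice of fsf by <:].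
HB.instance Definition _ := [SubChoice_isSubLmodule of fsf by <:].

Definition coef (b : B) (x : fsf) : rat := fsval x b.

Lemma coefB b x y : coef b (x - y) = coef b x - coef b y.
Proof. by []. Qed.
Lemma coefD b x y : coef b (x + y) = coef b x + coef b y.
Proof. by []. Qed.
Lemma coefZ b a x : coef b (a *: x) = a * coef b x.
Proof. by []. Qed.
Lemma coef0 b : coef b 0 = 0.
Proof. by []. Qed.
Lemma coef_sum b (I : Type) (r : seq I) (P : pred I) (F : I -> fsf) :
  coef b (\sum_(i <- r | P i) F i) = \sum_(i <- r | P i) coef b (F i).
Proof. by elim/big_rec2: _ => [//|i x y _ <-]; rewrite coefD. Qed.
Lemma coefMz b x (k : int) : coef b (x *~ k) = coef b x *~ k.
Proof. by rewrite -scaler_int coefZ mulrC mulrzr. Qed.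

Lemma fsf_eqP (x y : fsf) : (forall b, coef b x = coef b y) -> x = y.
Proof. by move=> h; apply: val_inj; apply/funext => b; exact: h. Qed.

Lemma dom_subproof (x : fsf) :
  {s : seq B | uniq s /\ forall b, (b \in s) = (coef b x != 0)}.
Proof.
apply: cid; have /asboolP[s hs] := valP x.
exists [seq b <- undup s | coef b x != 0]; split; first by rewrite filter_uniq // undup_uniq.
move=> b; rewrite mem_filter mem_undup andbC.
by case: (boolP (b \in s)) => // /hs bx; rewrite (_ : coef b x = 0) ?eqxx.
Qed.

Definition dom x := sval (dom_subproof x).

Lemma dom_uniq x : uniq (dom x).
Proof. by rewrite /dom; case: dom_subproof => ? []. Qed.

Lemma mem_dom x b : (b \in dom x) = (coef b x != 0).
Proof. by rewrite /dom; case: dom_subproof => ? []. Qed.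

Fact unit_subproof (b : B) :
  (fun c => (c == b)%:R : rat^o) \in finsupp_pred.
Proof.
by apply/asboolP; exists [:: b] => c; rewrite inE => /negPf ->.
Qed.

Definition unit b := Fsf (unit_subproof b).

Lemma coef_unit b c : coef c (unit b) = (c == b)%:R.
Proof. by []. Qed.

(** The linear map with values [f] on the basis formed by the [unit b]. *)
Definition lift (V : lmodType rat) (f : B -> V) (x : fsf) : V :=
  \sum_(b <- dom x) coef b x *: f b.

Lemma lift_wide (V : lmodType rat) (f : B -> V) x (s : seq B) :
  uniq s -> {subset dom x <= s} -> lift f x = \sum_(b <- s) coef b x *: f b.
Proof.
move=> us sub; rewrite /lift [RHS](bigID (mem (dom x))) /=.
rewrite [X in _ + X]big1 ?addr0; last first.
  by move=> b; rewrite mem_dom negbK => /eqP ->; rewrite scale0r.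
rewrite -[RHS]big_filter; apply: perm_big; apply: uniq_perm; rewrite ?filter_uniq ?dom_uniq //.
by move=> b; rewrite mem_filter; case: (boolP (b \in dom x)) => // /sub ->.
Qed.

Fact lift_is_linear (V : lmodType rat) (f : B -> V) : linear (lift f).
Proof.
move=> a x y; pose s := undup (dom x ++ dom y).
have us : uniq s by exact: undup_uniq.
have sx : {subset dom x <= s} by move=> b; rewrite mem_undup mem_cat => ->.
have sy : {subset dom y <= s} by move=> b; rewrite mem_undup mem_cat orbC => ->.
rewrite (lift_wide f us sx) (lift_wide f us sy) (@lift_wide _ f _ s) //; last first.
  move=> b; rewrite mem_undup mem_cat !mem_dom coefD coefZ.
  apply: contraR; rewrite negb_or !negbK => /andP[/eqP -> /eqP ->].
  by rewrite mulr0 addr0.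
rewrite scaler_sumr -big_split; apply: eq_bigr => b _.
by rewrite coefD coefZ scalerDl scalerA.
Qed.

HB.instance Definition _ (V : lmodType rat) (f : B -> V) :=
  GRing.isLinear.Build rat fsf V *:%R (lift f) (lift_is_linear f).

Lemma lift_unit (V : lmodType rat) (f : B -> V) b : lift f (unit b) = f b.
Proof.
rewrite (@lift_wide _ f (unit b) [:: b]) //.
  by rewrite big_seq1 coef_unit eqxx scale1r.
by move=> c; rewrite mem_dom coef_unit inE; case: (c == b).
Qed.

Lemma eq_lift (V : lmodType rat) (f g : B -> V) x :
  (forall b, coef b x != 0 -> f b = g b) -> lift f x = lift g x.
Proof.
move=> h; rewrite /lift big_seq [RHS]big_seq; apply: eq_bigr => b.
by rewrite mem_dom => /h ->.
Qed.

Lemma lift_id x : lift unit x = x.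
Proof.
apply: fsf_eqP => b; rewrite /lift coef_sum.
under eq_bigr do rewrite coefZ coef_unit.
have [bx|bx] := boolP (b \in dom x).
  rewrite (bigD1_seq b) ?dom_uniq //= eqxx mulr1 big1 ?addr0 // => c /negPf h.
  by rewrite eq_sym h mulr0.
have -> : coef b x = 0 by apply/eqP; rewrite mem_dom negbK in bx.
rewrite big_seq big1 // => c cx; rewrite (_ : (b == c) = false) ?mulr0 //.
by apply: contraNF bx => /eqP ->.
Qed.

Lemma fsf_sum x : x = \sum_(b <- dom x) coef b x *: unit b.
Proof. by rewrite -[LHS]lift_id. Qed.

End FinSupp.

Arguments coef : simpl never.

(** * Free groups *)

Lemma zmodClosed_of (A : zmodType) (P : A -> Prop) :
  P 0 -> (forall x y, P x -> P y -> P (x - y)) ->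
  exists B : zmodClosed A, forall x, x \in B <-> P x.
Proof.
move=> P0 PB; pose Q : {pred A} := [pred x | `[< P x >]].
have Qc : zmod_closed Q.
  split; first exact/asboolP.
  by move=> x y /asboolP hx /asboolP hy; apply/asboolP/PB.
pose m := GRing.isZmodClosed.Build A Q Qc.
pose B : zmodClosed A := HB.pack Q m.
by exists B => x; split => [/asboolP|h]; last exact/asboolP.
Qed.

Lemma mulrz_muln (M : zmodType) (x : M) (m : int) (n : nat) : x *~ (m *+ n) = x *~ m *+ n.
Proof. by rewrite -mulr_natr mulrzA mulrz_nat. Qed.

Lemma sum_wide (G : zmodType) (r u : seq G) (f : G -> int) :
  uniq r -> uniq u -> {subset r <= u} ->
  \sum_(z <- r) z *~ f z = \sum_(z <- u) z *~ (if z \in r then f z else 0).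
Proof.
move=> ur uu ru; rewrite [RHS](bigID (mem r)) /= [X in _ + X]big1 ?addr0; last first.
  by move=> i /negPf ->.
rewrite -[RHS]big_filter.
have -> : \sum_(i <- [seq i <- u | i \in r]) i *~ (if i \in r then f i else 0) =
          \sum_(i <- [seq i <- u | i \in r]) i *~ f i.
  by rewrite !big_filter; apply: eq_bigr => i ->.
apply: perm_big; apply: uniq_perm => //; first by rewrite filter_uniq.
by move=> i; rewrite mem_filter; case: (boolP (i \in r)) => // /ru ->.
Qed.

Lemma basis_uniq (G : zmodType) (X : set G) (g : G) : is_basis X ->
  exists (s : seq G) (c : G -> int),
    [/\ uniq s, [set` s] `<=` X & g = \sum_(x <- s) x *~ c x].
Proof.
move=> [_ /(_ g)[s [c [sX ->]]]].
exists (undup s), (fun x => c x *+ count_mem x s); split; first exact: undup_uniq.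
  by move=> x /=; rewrite mem_undup => xs; apply: sX.
rewrite -big_undup_iterop_count /=; apply: eq_bigr => x _.
by rewrite Monoid.iteropE iter_addr_0 mulrz_muln.
Qed.

(** Each coefficient of [x] in a basis is divisible by every power of [p]; for a nonzero coefficient
    c this fails at the exponent |c|, because p^|c| > |c|. *)
Lemma free_not_divisible (G : zmodType) (p : nat) (x : G) : (1 < p)%N ->
  free_group G -> (forall n, exists y, x = y *+ p ^ n) -> x = 0.
Proof.
move=> p1 [X Xb] xdiv; have [s [c [us sX xE]]] := basis_uniq x Xb.
have cdiv n z : z \in s -> (Posz (p ^ n)%N %| c z)%Z.
  move=> zs; have [y xy] := xdiv n; have [t [e [ut tX yE]]] := basis_uniq y Xb.
  pose u := undup (s ++ t).
  pose c' z := if z \in s then c z else 0.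
  pose e' z := if z \in t then e z else 0.
  have E : \sum_(z <- u) z *~ (c' z - e' z *+ (p ^ n)%N) = 0.
    under eq_bigr do rewrite mulrzBr.
    rewrite sumrB -(@sum_wide _ s u c) ?undup_uniq //; last first.
      by move=> i si; rewrite mem_undup mem_cat si.
    rewrite -xE; apply/eqP; rewrite subr_eq0 {1}xy yE; apply/eqP.
    rewrite (@sum_wide _ t u) ?undup_uniq //; last first.
      by move=> i si; rewrite mem_undup mem_cat si orbT.
    by rewrite -sumrMnl; apply: eq_bigr => i _; rewrite mulrz_muln.
  have zu : z \in u by rewrite mem_undup mem_cat zs.
  have := Xb.1 u _ (undup_uniq _) _ E z zu; rewrite /c' zs => h.
  have /eqP : c z - e' z *+ (p ^ n)%N = 0.
    apply: h => i /=; rewrite mem_undup mem_cat => /orP[/sX|/tX] //.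
  rewrite subr_eq0 => /eqP ->; rewrite -mulr_natr dvdz_mull //.
  by rewrite natz.
rewrite xE big_seq big1 // => z zs; have := cdiv `|c z|%N z zs.
have [->|nz] := eqVneq (c z) 0; first by rewrite mulr0z.
rewrite dvdzE /= => /dvdn_leq; rewrite absz_gt0 => /(_ nz).
by rewrite leqNgt ltn_expl.
Qed.

Lemma int_subgroup_generator (P : int -> Prop) :
  P 0 -> (forall m n, P m -> P n -> P (m - n)) ->
  exists2 g, P g & forall m, P m -> (g %| m)%Z.
Proof.
move=> P0 PB.
have PN m : P m -> P (- m) by rewrite -sub0r; exact: PB.
have PD m n : P m -> P n -> P (m + n) by move=> hm hn; rewrite -[n]opprK; apply/PB/PN.
have [[m Pm m0]|no] := pselect (exists2 m, P m & m != 0); last first.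
  exists 0 => // m Pm; apply: contrapT => h; apply: no; exists m => //.
  by apply/eqP => m0; apply: h; rewrite m0.
have ex : exists n : nat, (0 < n)%N && `[< P n%:Z >].
  exists `|m|%N; rewrite absz_gt0 m0 /=; apply/asboolP.
  by case: (ger0P m) => [/gez0_abs ->|/ltW/lez0_abs ->] //; exact: PN.
have [n /andP[n0 /asboolP Pn] nmin] := find_ex_minn ex.
exists n%:Z => // k Pk; apply/dvdz_mod0P.
have Pmul (j : nat) : P (n%:Z * j%:Z).
  by elim: j => [|j IH]; rewrite ?mulr0 // -[j.+1]addn1 PoszD mulrDr mulr1; exact: PD.
have Pm' : P (k %% n)%Z.
  rewrite /modz; apply: PB => //; rewrite mulrC.
  by case: (k %/ n)%Z => j //; rewrite NegzE mulrN; exact/PN.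
have n0' : n%:Z != 0 by rewrite -lt0n.
have := modz_ge0 k n0'; case E: (k %% n)%Z Pm' => [j|//] Pj _.
have := ltz_pmod k (d := n); rewrite E ltz_nat => /(_ n0) jn.
apply/eqP; apply: contraTT jn => j0; rewrite -leqNgt; apply: nmin.
by rewrite lt0n j0; exact/asboolP.
Qed.

(* The elements on which phi k vanishes for k >= n form a chain whose successive
   quotients are mapped by phi n onto cyclic groups; lifting generators of these
   gives the basis. *)
Lemma free_criterion (G : zmodType) (phi : nat -> {additive G -> rat}) :
  (forall g, exists n, forall k, (n <= k)%N -> phi k g = 0) ->
  (forall g, (forall k, phi k g = 0) -> g = 0) ->
  (forall n, exists2 m : nat, m != 0%N &
    forall g, (forall k, (n < k)%N -> phi k g = 0) -> phi n g *+ m \is a Num.int) ->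
  free_group G.
Proof.
move=> hfin hsep hden; pose G_ n g := forall k, (n <= k)%N -> phi k g = 0.
have GB n g h : G_ n g -> G_ n h -> G_ n (g - h).
  by move=> hg hh k nk; rewrite raddfB hg // hh // subrr.
have GM n g (c : int) : G_ n g -> G_ n (g *~ c).
  by move=> hg k nk; rewrite raddfMz hg // mul0rz.
(* Multiplied by [m], the values of [phi n] on [G_ n.+1] form a subgroup of the integers, hence are
   the multiples of one of them. *)
have gen n : exists2 b, G_ n.+1 b &
    forall g, G_ n.+1 g -> exists c : int, phi n g = phi n b *~ c.
  have [m m0 hm] := hden n.
  have [||c [b Gb bc] cmin] := @int_subgroup_generator
    (fun c => exists2 g, G_ n.+1 g & phi n g *+ m = c%:~R).
  - by exists 0 => [k _|]; rewrite raddf0 ?mul0rn.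
  - move=> c e [g Gg gc] [h Gh he]; exists (g - h); first exact: GB.
    by rewrite raddfB mulrnBl gc he rmorphB.
  exists b => // g Gg; have /intrP[e ge] := hm g Gg.
  have /dvdzP[q eq] := cmin e (ex_intro2 _ _ g Gg ge).
  exists q; apply: (@mulIf _ m%:R); first by rewrite pnatr_eq0.
  rewrite mulr_natr ge eq rmorphM /= -bc.
  by rewrite -[phi n b *~ q]mulrzr -[phi n b *+ m]mulr_natr mulrCA mulrA.
have [b hb] := choice (fun n => let: ex_intro2 b h1 h2 := gen n in
  ex_intro (fun b => G_ n.+1 b /\ forall g, G_ n.+1 g -> exists c : int, phi n g = phi n b *~ c)
    b (conj h1 h2)).
pose X := [set g | exists2 n, g = b n & phi n (b n) != 0].
have bphi k n : (k < n)%N -> phi n (b k) = 0 by exact: (hb k).1.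
exists X; split=> [s c us sX sum0 x xs|g].
  apply/eqP; apply: contrapT => /negP cx.
  have [idx hidx] : exists idx : G -> nat, forall y, X y -> y = b (idx y) /\ phi (idx y) y != 0.
    have /choice[idx h] : forall y, exists n, X y -> y = b n /\ phi n y != 0.
      by move=> y; have [[n -> h]|h] := pselect (X y); [exists n|exists 0%N].
    by exists idx.
  (* Among the terms of the relation with nonzero coefficient, take one of largest index: [phi] at
     that index annihilates the others. *)
  have [z] : exists z, [/\ z \in s, c z != 0 &
      forall y, y \in s -> c y != 0 -> (idx y <= idx z)%N].
    elim: s x xs cx {us sX sum0} => // y s IH x; rewrite inE => /orP[/eqP<- cx|xs cx].
      have [[w ws cw]|no] := pselect (exists2 w, w \in s & c w != 0); last first.
        exists x; split=> //; first exact: mem_head.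
        move=> w; rewrite inE => /orP[/eqP->//|ws cw].
        by case: no; exists w.
      have [z [zs cz zmax]] := IH w ws cw.
      have [zx|xz] := leqP (idx z) (idx x).
        exists x; split=> //; first exact: mem_head.
        move=> v; rewrite inE => /orP[/eqP->//|vs cv]; exact: leq_trans (zmax v vs cv) zx.
      exists z; split=> //; first by rewrite inE zs orbT.
      by move=> v; rewrite inE => /orP[/eqP->_|]; [exact: ltnW|exact: zmax].
    have [z [zs cz zmax]] := IH x xs cx.
    have [zy|yz] := boolP ((c y != 0) && (idx z <= idx y)%N).
      have /andP[cy zy'] := zy; exists y; split=> //; first exact: mem_head.
      move=> v; rewrite inE => /orP[/eqP->//|vs cv]; exact: leq_trans (zmax v vs cv) zy'.
    exists z; split=> //; first by rewrite inE zs orbT.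
    move=> v; rewrite inE => /orP[/eqP-> cy|]; last exact: zmax.
    by move: yz; rewrite cy /= -ltnNge; exact: ltnW.
  move=> [zs cz zmax]; have [zb zphi] := hidx z (sX z zs).
  have := congr1 (phi (idx z)) sum0; rewrite raddf0 raddf_sum (bigD1_seq z) //= big_seq_cond big1.
    rewrite addr0 raddfMz -mulrzr => /eqP; rewrite mulf_eq0 intr_eq0.
    by rewrite (negPf cz) (negPf zphi).
  move=> y /andP[ys yz]; rewrite raddfMz; have [->|cy] := eqVneq (c y) 0; first by rewrite mulr0z.
  have [yb _] := hidx y (sX y ys); rewrite yb bphi ?mul0rz //.
  rewrite ltn_neqAle zmax // andbT; apply: contraNN yz => /eqP e.
  by rewrite yb zb e.
suff H n : G_ n g -> exists (s : seq G) (c : G -> int),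
    [/\ uniq s, [set` s] `<=` X & g = \sum_(x <- s) x *~ c x].
  by have [n /H[s [c [_ sX gE]]]] := hfin g; exists s, c.
elim: n g => [|n IH] g Gg.
  exists [::], (fun=> 0); split=> //; rewrite big_nil; apply: hsep => k; exact: Gg.
have [c gc] := (hb n).2 g Gg.
(* If [phi n (b n)] is zero, [phi n] vanishes on all of [G_ n.+1], and no basis element is
   contributed. *)
have [b0|bn] := eqVneq (phi n (b n)) 0.
  apply: IH => k; rewrite leq_eqVlt => /orP[/eqP <-|]; last exact: Gg.
  by rewrite gc b0 mul0rz.
have Gh : G_ n (g - b n *~ c).
  move=> k; rewrite leq_eqVlt => /orP[/eqP <-|nk].
    by rewrite raddfB raddfMz /= gc subrr.
  by apply: (GB n.+1) nk => //; apply/GM/(hb n).1.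
have [s [e [us sX gE]]] := IH _ Gh.
pose u := undup (b n :: s).
exists u, (fun z => (if z \in s then e z else 0) + (if z \in [:: b n] then c else 0)).
split; first exact: undup_uniq.
  by move=> z /=; rewrite mem_undup inE => /orP[/eqP->|/sX //]; exists n.
under eq_bigr do rewrite mulrzDr.
rewrite big_split /= -(@sum_wide _ s u) ?undup_uniq //; last first.
  by move=> z zs; rewrite mem_undup inE zs orbT.
rewrite -(@sum_wide _ [:: b n] u) ?undup_uniq //; last first.
  by move=> z; rewrite mem_undup !inE => ->.
by rewrite big_seq1 -gE subrK.
Qed.

(** * The group and its retractions *)

(** Coprimality of [1 + p k] and [p ^ n], applied to the denominator of [q]; the induction removes
    one factor [p] at a time. *)
Lemma int_cancel (p : nat) (q : rat) (k : int) n :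
  q * (1 + p%:R * k%:~R) \is a Num.int -> p%:R ^+ n * q \is a Num.int -> q \is a Num.int.
Proof.
move=> hk; elim: n => [|n IH]; first by rewrite expr0 mul1r.
rewrite exprSr -mulrA => h; apply: IH.
have -> : p%:R ^+ n * q = p%:R ^+ n * (q * (1 + p%:R * k%:~R)) - p%:R ^+ n * (p%:R * q) * k%:~R.
  rewrite -mulrA -mulrBr; congr (_ * _).
  by rewrite mulrDr mulr1 mulrA [q * _]mulrC addrK.
by rewrite rpredB // rpredM // ?intr_int // rpredX // natr_int.
Qed.

Lemma count_lt (T : eqType) (a1 a2 : pred T) (s : seq T) x :
  subpred a1 a2 -> x \in s -> a2 x -> ~~ a1 x -> (count a1 s < count a2 s)%N.
Proof.
move=> sub + h2 h1; elim: s => // z s IH; rewrite inE => /orP[/eqP <-|/IH] /=.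
  by rewrite h2 (negPf h1) ltnS; exact: sub_count.
by case: (boolP (a1 z)) => [/sub ->//|_ h]; apply: ltn_addl.
Qed.

Section Group.
Context (d : Order.disp_t) (W : orderType d) (hW : is_omega1 W).
Context (S : set W) (hSlim : forall a, S a -> is_limit a) (p : nat) (hp : prime p).
Local Notation B := (W * nat)%type.
Local Notation D := (fsf B).
Implicit Types (a mu nu delta : W) (b : B) (x : D).

(** The integral vectors: the free group on the [unit b] of levels outside [S]. *)
Definition lattice x :=
  forall b, coef b x \is a Num.int /\ (coef b x != 0 -> ~ S b.1).

Definition below_level a x := forall b, coef b x != 0 -> (b.1 < a)%O.

Lemma lattice0 : lattice 0.
Proof. by move=> b; rewrite coef0 eqxx. Qed.

Lemma latticeB x x' : lattice x -> lattice x' -> lattice (x - x').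
Proof.
move=> h h' b; rewrite coefB rpredB ?(h b).1 ?(h' b).1 //; split=> //.
have [e|/(h b).2 //] := eqVneq (coef b x) 0.
by rewrite e sub0r oppr_eq0; exact: (h' b).2.
Qed.

Lemma latticeD x x' : lattice x -> lattice x' -> lattice (x + x').
Proof.
move=> h h'; have l0 := lattice0; rewrite -[x']opprK -[- x']sub0r; apply: latticeB => //; exact: latticeB.
Qed.

Lemma below_level0 a : below_level a 0.
Proof. by move=> b; rewrite coef0 eqxx. Qed.

Lemma below_levelB a x x' : below_level a x -> below_level a x' -> below_level a (x - x').
Proof.
move=> h h' b; rewrite coefB; have [e|/h //] := eqVneq (coef b x) 0.
by rewrite e sub0r oppr_eq0; exact: h'.
Qed.

Lemma below_levelZ a q x : below_level a x -> below_level a (q *: x).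
Proof. by move=> h b; rewrite coefZ mulf_eq0 negb_or => /andP[_ /h]. Qed.

Lemma below_levelD a x x' : below_level a x -> below_level a x' -> below_level a (x + x').
Proof.
move=> h h' b; rewrite coefD; have [e|/h //] := eqVneq (coef b x) 0.
by rewrite e add0r; exact: h'.
Qed.

Lemma below_level_sum a I (r : seq I) (P : pred I) (F : I -> D) :
  (forall i, P i -> below_level a (F i)) -> below_level a (\sum_(i <- r | P i) F i).
Proof.
move=> h; elim/big_rec: _ => [|i x Pi hx]; first exact: below_level0.
exact/below_levelD/hx/h.
Qed.

Lemma below_levelW a a' x : (a <= a')%O -> below_level a x -> below_level a' x.
Proof. by move=> aa h b /h /lt_le_trans; apply. Qed.

Lemma below_level_unit a b : (b.1 < a)%O -> below_level a (unit b).
Proof.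
by move=> ba c; rewrite coef_unit; case: (c =P b) => [->|_] //; rewrite eqxx.
Qed.

Lemma below_level_coef0 a x b : below_level a x -> (a <= b.1)%O -> coef b x = 0.
Proof. by move=> h ab; apply/eqP; apply: contraTT ab => /h; rewrite -ltNge. Qed.

Lemma exists_below_level x : exists a, below_level a x.
Proof.
have [|a h] := @countable_bounded _ _ hW [set` [seq b.1 | b <- dom x]].
  exact/finite_set_countable/finite_seq.
by exists a => b bx; apply: h => /=; apply: map_f; rewrite mem_dom.
Qed.

Lemma closedMz (P : D -> Prop) x (k : int) : P 0 -> (forall x x', P x -> P x' -> P (x - x')) ->
  P x -> P (x *~ k).
Proof.
move=> P0 PB Px; have PN z : P z -> P (- z) by rewrite -sub0r; exact: PB.
have Pn (n : nat) : P (x *+ n).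
  by elim: n => // n IH; rewrite mulrSr -[x in _ + x]opprK; apply/PB/PN.
by case: k => n; [exact: Pn|rewrite NegzE mulrNz; exact/PN/Pn].
Qed.

Lemma closed_sum (P : D -> Prop) I (r : seq I) (Q : pred I) (F : I -> D) :
  P 0 -> (forall x x', P x -> P x' -> P (x - x')) ->
  (forall i, Q i -> P (F i)) -> P (\sum_(i <- r | Q i) F i).
Proof.
move=> P0 PB h; have PN z : P z -> P (- z) by rewrite -sub0r; exact: PB.
by elim/big_rec: _ => // i x Qi Px; rewrite -[x]opprK; apply/PB/PN => //; exact: h.
Qed.

Lemma lattice_ind (P : D -> Prop) x : P 0 -> (forall x x', P x -> P x' -> P (x - x')) ->
  (forall b, ~ S b.1 -> coef b x != 0 -> P (unit b)) -> lattice x -> P x.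
Proof.
move=> P0 PB Pu Lx; rewrite (fsf_sum x) big_seq; apply: closed_sum => // b.
rewrite mem_dom => bx; have /intrP[k ->] := (Lx b).1.
by rewrite scaler_int; apply: closedMz => //; apply: Pu => //; exact: (Lx b).2.
Qed.

Lemma lattice_unit b : ~ S b.1 -> lattice (unit b).
Proof.
move=> nb c; rewrite coef_unit natr_int; split=> //.
by case: (c =P b) => [->|_] //; rewrite eqxx.
Qed.

Lemma latticeMz x (k : int) : lattice x -> lattice (x *~ k).
Proof. by apply: closedMz; [exact: lattice0|exact: latticeB]. Qed.

Lemma latticeXn x n : lattice x -> lattice (p%:R ^+ n *: x).
Proof.
move=> h; rewrite -natrX scaler_nat -[_ *+ _]/(x *~ (p ^ n)%N); exact: latticeMz.
Qed.

Lemma lattice_sum I (r : seq I) (P : pred I) (F : I -> D) :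
  (forall i, P i -> lattice (F i)) -> lattice (\sum_(i <- r | P i) F i).
Proof. by apply: closed_sum; [exact: lattice0|exact: latticeB]. Qed.

Definition below_le mu x := forall b, coef b x != 0 -> (b.1 <= mu)%O.

Lemma below_le_sum mu I (r : seq I) (P : pred I) (F : I -> D) :
  (forall i, P i -> below_le mu (F i)) -> below_le mu (\sum_(i <- r | P i) F i).
Proof.
move=> h b; rewrite coef_sum => nz.
have [i Pi bi] : exists2 i, P i & coef b (F i) != 0.
  apply: contrapT => no; move/eqP: nz; apply; apply: big1 => i Pi.
  by apply/eqP; apply: contrapT => /negP bi; apply: no; exists i.
exact: h bi.
Qed.

Lemma below_leZ mu q x : below_le mu x -> below_le mu (q *: x).
Proof. by move=> h b; rewrite coefZ mulf_eq0 negb_or => /andP[_ /h]. Qed.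

Lemma below_le_unit mu b : (b.1 <= mu)%O -> below_le mu (unit b).
Proof. by move=> ba c; rewrite coef_unit; case: (c =P b) => [->|_] //; rewrite eqxx. Qed.

Lemma below_le0 mu : below_le mu 0.
Proof. by move=> b; rewrite coef0 eqxx. Qed.

Lemma below_leB mu x x' : below_le mu x -> below_le mu x' -> below_le mu (x - x').
Proof.
move=> h h' b; rewrite coefB; have [e|/h //] := eqVneq (coef b x) 0.
by rewrite e sub0r oppr_eq0; exact: h'.
Qed.

Lemma below_level_le mu x : below_level mu x -> below_le mu x.
Proof. by move=> h b /h/ltW. Qed.

(* code (nu, k) = (mu, c) means that the k-th generator of level nu is mapped to
   the generator c by the retraction onto the levels <= mu. *)
Variable code : B -> W * B.
Hypothesis code_surj : forall nu mu (c : B), (c.1 <= mu)%O -> (mu <= nu)%O ->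
  exists k, code (nu, k) = (mu, c).

(** A generator above [mu] is mapped to 0 unless its code names [mu], so at most one retraction with
    [mu] below its level is nonzero on it; hence the independence of the retractions. The target
    must lie outside [S] so that integral vectors stay integral. *)
Definition retract_gen mu b : D :=
  if (b.1 <= mu)%O then unit b else
  if `[< [/\ ~ S b.1, (code b).1 = mu, ((code b).2.1 <= mu)%O & ~ S (code b).2.1] >]
  then unit (code b).2 else 0.

Definition retract mu : D -> D := lift (retract_gen mu).

Lemma retractB mu x x' : retract mu (x - x') = retract mu x - retract mu x'.
Proof. exact: raddfB. Qed.

Lemma retractD mu x x' : retract mu (x + x') = retract mu x + retract mu x'.
Proof. exact: raddfD. Qed.

Lemma retract_sum mu I (r : seq I) (P : pred I) (F : I -> D) :
  retract mu (\sum_(i <- r | P i) F i) = \sum_(i <- r | P i) retract mu (F i).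
Proof. exact: raddf_sum. Qed.

Lemma retractZ mu q x : retract mu (q *: x) = q *: retract mu x.
Proof. exact: linearZ. Qed.

Lemma retract0 mu : retract mu 0 = 0.
Proof. exact: raddf0. Qed.

Lemma retract_gen_le mu b : below_le mu (retract_gen mu b).
Proof.
rewrite /retract_gen; case: ifP => [h|_]; first exact: below_le_unit.
by case: asboolP => [[_ _ h _]|_]; [exact: below_le_unit|exact: below_le0].
Qed.

Lemma retract_le mu x : below_le mu (retract mu x).
Proof. by apply: below_le_sum => b _; apply/below_leZ/retract_gen_le. Qed.

Lemma retract_lattice mu x : lattice x -> lattice (retract mu x).
Proof.
pose P x := lattice (retract mu x); move=> Lx.
apply: (lattice_ind (P := P)) Lx; rewrite /P.
- by rewrite retract0; exact: lattice0.
- by move=> z z'; rewrite retractB; exact: latticeB.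
- move=> b nb _; rewrite /retract lift_unit /retract_gen; case: ifP => _; first exact: lattice_unit.
  by case: asboolP => [[_ _ _ h]|_]; [exact: lattice_unit|exact: lattice0].
Qed.

(** For a generator [b] of [v], the generator of level [nu] with code [(mu, b)] goes to [unit b]
    under the retraction at [mu] and to 0 under every other one below [nu]. *)
Lemma exists_shift mu nu v : lattice v -> below_le mu v -> ~ S nu -> (mu < nu)%O ->
  exists w : D, [/\ lattice w, retract mu w = v &
    forall mu', mu' != mu -> (mu' < nu)%O -> retract mu' w = 0].
Proof.
move=> Lv vmu nS munu.
apply: (lattice_ind (P := fun v => exists w : D, [/\ lattice w, retract mu w = v &
    forall mu', mu' != mu -> (mu' < nu)%O -> retract mu' w = 0])) Lv.
- by exists 0; split=> [||mu' _ _]; rewrite ?retract0 //; exact: lattice0.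
- move=> z z' [a [La ha ka]] [a' [La' ha' ka']]; exists (a - a').
  split=> [||mu' m1 m2]; first exact: latticeB.
    by rewrite retractB ha ha'.
  by rewrite retractB ka // ka' // subrr.
- move=> b nb /vmu bmu; have [k hk] := code_surj bmu (ltW munu).
  exists (unit (nu, k)); split; first exact: lattice_unit.
    rewrite /retract lift_unit /retract_gen /= leNgt munu /= hk /=.
    by rewrite asboolT.
  move=> mu' m1 m2; rewrite /retract lift_unit /retract_gen /= leNgt m2 /= hk /=.
  by case: asboolP => // -[_ e]; rewrite e eqxx in m1.
Qed.

(** A generator of level [nu] whose code names [nu] itself is sent to 0 by the retractions at all
    smaller levels. *)
Lemma exists_killed nu : ~ S nu ->
  exists2 b, b.1 = nu & forall mu, (mu < nu)%O -> retract mu (unit b) = 0.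
Proof.
move=> nS; have [k hk] := @code_surj nu nu (nu, 0%N) (lexx _) (lexx _).
exists (nu, k) => // mu h; rewrite /retract lift_unit /retract_gen /= leNgt h /= hk /=.
by case: asboolP => // -[_ e]; rewrite e ltxx in h.
Qed.

(** * The elements [zgen] and the group they generate with the integral vectors *)

Section WithY.
Variable y : W -> nat -> D.

Definition eta n delta : D := \sum_(0 <= j < n) p%:R ^+ j *: y delta j.

(** Reduction modulo the elements [p ^ n zgen(delta, n)]: each [unit (delta, 0)] with delta in [S]
    is replaced by the vector [- eta n delta] congruent to it. *)
Definition residue n : D -> D :=
  lift (fun b => if `[< S b.1 >] then - eta n b.1 else unit b).

(* The subgroup generated by the integral vectors and the [zgen delta n]; described
   through residues, membership of x visibly depends only on the y delta with
   delta a level occurring in x, as the recursion constructing y requires. *)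
Definition Aset x := exists N, forall n, (N <= n)%N -> lattice (residue n x) /\
  forall b, S b.1 -> p%:R ^+ n * coef b x \is a Num.int /\ (b.2 != 0%N -> coef b x = 0).

Definition zgen delta n : D := (p%:R ^+ n)^-1 *: (unit (delta, 0%N) + eta n delta).

Hypothesis y_lattice : forall delta j, S delta -> lattice (y delta j).
Hypothesis y_below : forall delta j, S delta -> below_level delta (y delta j).

Lemma eta_lattice n delta : S delta -> lattice (eta n delta).
Proof. by move=> hd; apply: lattice_sum => j _; apply/latticeXn/y_lattice. Qed.

Lemma eta_below n delta : S delta -> below_level delta (eta n delta).
Proof. by move=> hd; apply: below_level_sum => j _; apply/below_levelZ/y_below. Qed.

Lemma Aset0 : Aset 0.
Proof.
exists 0%N => n _; rewrite /residue raddf0; split; first exact: lattice0.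
by move=> b _; rewrite coef0 mulr0.
Qed.

Lemma AsetB x x' : Aset x -> Aset x' -> Aset (x - x').
Proof.
move=> [N hN] [N' hN']; exists (maxn N N') => n; rewrite geq_max => /andP[/hN[h1 h2] /hN'[h1' h2']].
rewrite /residue raddfB; split; first exact: latticeB.
move=> b Sb; rewrite coefB mulrBr rpredB ?(h2 b Sb).1 ?(h2' b Sb).1 //; split=> // b0.
by rewrite (h2 b Sb).2 // (h2' b Sb).2 // subrr.
Qed.

Lemma residue_lattice n x : lattice x -> residue n x = x.
Proof.
move=> h; rewrite -[RHS]lift_id; apply: eq_lift => b /(h b).2.
by case: asboolP.
Qed.

Lemma lattice_Aset x : lattice x -> Aset x.
Proof.
move=> h; exists 0%N => n _; rewrite residue_lattice //; split=> // b Sb.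
have -> : coef b x = 0 by apply/eqP; apply: contrapT => /negP/(h b).2.
by rewrite mulr0.
Qed.

Lemma residueE n x : residue n x =
  x - \sum_(b <- dom x | `[< S b.1 >]) coef b x *: (unit b + eta n b.1).
Proof.
rewrite {2}(fsf_sum x) /residue /lift (bigID (fun b => `[< S b.1 >])) /=.
rewrite [in RHS](bigID (fun b => `[< S b.1 >])) /= addrAC -sumrB.
congr (_ + _); apply: eq_bigr => b; last by move=> /negPf ->.
by move=> ->; rewrite -scalerBr opprD addrA subrr add0r.
Qed.

Lemma zgenE delta n : p%:R ^+ n *: zgen delta n = unit (delta, 0%N) + eta n delta.
Proof.
rewrite scalerA divff ?scale1r // expf_neq0 // pnatr_eq0 -lt0n; exact: prime_gt0.
Qed.

(** Telescoping the defining equations: the index of [zgen] can be raised at the cost of an integral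
    vector. *)
Lemma zgen_step delta n m : (n <= m)%N ->
  exists2 l, (S delta -> lattice l) & zgen delta n = p%:R ^+ (m - n) *: zgen delta m - l.
Proof.
move=> nm; have p0 : p%:R != 0 :> rat by rewrite pnatr_eq0 -lt0n prime_gt0.
exists (\sum_(n <= j < m) p%:R ^+ (j - n) *: y delta j).
  by move=> hd; apply: lattice_sum => j _; apply/latticeXn/y_lattice.
apply: (scalerI (expf_neq0 n p0)); rewrite zgenE scalerBr scalerA -exprD subnKC // zgenE.
have -> : p%:R ^+ n *: (\sum_(n <= j < m) p%:R ^+ (j - n) *: y delta j) =
          \sum_(n <= j < m) p%:R ^+ j *: y delta j.
  rewrite scaler_sumr; apply: eq_big_nat => j /andP[nj _].
  by rewrite scalerA -exprD subnKC.
by rewrite /eta (big_cat_nat (n := n) (p := m)) //= [in RHS]addrA addrK.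
Qed.

Lemma residue_zgen delta n : S delta -> residue n (zgen delta n) = 0.
Proof.
move=> hd; rewrite /residue linearZ /= linearD /= lift_unit /=; case: asboolP => // _.
by rewrite -/(residue n _) residue_lattice ?addNr ?scaler0 //; exact: eta_lattice.
Qed.

Lemma zgen_Aset delta n : S delta -> Aset (zgen delta n).
Proof.
move=> hd; exists n => m nm; split.
  have [l /(_ hd) Ll ->] := zgen_step delta nm.
  rewrite /residue linearB linearZ /= -!/(residue _ _) residue_zgen // scaler0 residue_lattice //.
  by apply: latticeB => //; exact: lattice0.
move=> b Sb; rewrite coefZ coefD coef_unit.
have -> : coef b (eta n delta) = 0.
  by apply/eqP; apply: contrapT => /negP/(eta_lattice n hd b).2.
rewrite addr0 mulrA -(subnK nm) exprD mulfK; last first.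
  by rewrite expf_neq0 // pnatr_eq0 -lt0n prime_gt0.
split; first by rewrite rpredM ?rpredX ?natr_int.
by case: b {Sb} => b1 b2 /= b20; rewrite xpair_eqE (negPf b20) andbF mulr0.
Qed.

Lemma Aset_decomposition x : Aset x -> exists N, forall n, (N <= n)%N ->
  lattice (residue n x) /\
  forall b, S b.1 -> coef b x != 0 ->
    exists k : int, coef b x *: (unit b + eta n b.1) = zgen b.1 n *~ k.
Proof.
move=> [N hN]; exists N => n /hN[h1 h2]; split=> // b Sb bx.
have [/intrP[k hk] b2] := h2 b Sb; exists k.
have b20 : b.2 = 0%N by apply/eqP; apply: contrapT => /negP/b2 b0; rewrite b0 eqxx in bx.
have -> : unit b = unit (b.1, 0%N) by rewrite -b20; case: (b).
by rewrite -zgenE scalerA mulrC hk scaler_int.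
Qed.

(** For large [N] an element is its residue, an integral vector, plus integral multiples of elements
    [zgen delta N]; neither part leaves the levels below [a], because [y delta] lives below
    [delta]. *)
Lemma Aset_ind (P : D -> Prop) a x : P 0 -> (forall x x', P x -> P x' -> P (x - x')) ->
  (forall b, ~ S b.1 -> (b.1 < a)%O -> P (unit b)) ->
  (forall delta n, S delta -> (delta < a)%O -> P (zgen delta n)) ->
  Aset x -> below_level a x -> P x.
Proof.
move=> P0 PB Pu Pz Ax xa; have [N hN] := Aset_decomposition Ax.
have [h1 h2] := hN N (leqnn N).
have := residueE N x; set s := \sum_(b <- _ | _) _ => xE.
have -> : x = residue N x - (- s) by rewrite xE opprK subrK.
have sa : below_level a s.
  rewrite /s big_seq_cond; apply: below_level_sum => b /andP[]; rewrite mem_dom => bx /asboolP Sb.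
  apply: below_levelZ; apply: below_levelD; first exact/below_level_unit/xa.
  exact/(below_levelW (ltW (xa _ bx)))/eta_below.
apply: (PB).
  apply: lattice_ind (h1) => // b nb bres; apply: Pu => //.
  have : below_level a (residue N x) by rewrite xE; exact: below_levelB.
  by apply.
rewrite -[- s]sub0r; apply: (PB) => //; rewrite /s big_seq_cond; apply: closed_sum => // b.
rewrite mem_dom => /andP[bx /asboolP Sb]; have [k ->] := h2 b Sb bx.
by apply: closedMz => //; apply: Pz => //; exact: xa.
Qed.

(** * Bounds on denominators above a level outside [S] *)

Lemma coef_residue n x b : ~ S b.1 -> coef b (residue n x) =
  coef b x - \sum_(c <- dom x | `[< S c.1 >]) coef c x * coef b (eta n c.1).
Proof.
move=> nb; rewrite residueE coefB coef_sum; congr (_ - _); apply: eq_bigr => c /asboolP Sc.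
rewrite coefZ coefD coef_unit; case: eqP => [e|_]; last by rewrite add0r.
by case: nb; rewrite e.
Qed.

(** The coefficient at [b] thus has p-adic valuation exactly [r] for all large [n]; the factor
    [1 + p k] is what [int_cancel] removes. *)
Hypothesis y_fresh : forall delta nu, S delta -> (nu < delta)%O ->
  exists b, [/\ (nu < b.1)%O, (b.1 < delta)%O, ~ S b.1 &
   exists r n0, forall n, (n0 <= n)%N ->
    exists k : int, coef b (eta n delta) = p%:R ^+ r * (1 + p%:R * k%:~R)].

Lemma uniform_denominator (Q : D -> Prop) (s : seq B) :
  (forall b, b \in s -> exists M, forall x, Q x -> p%:R ^+ M * coef b x \is a Num.int) ->
  exists M, forall x, Q x -> forall b, b \in s -> p%:R ^+ M * coef b x \is a Num.int.
Proof.
elim: s => [|b s IH] h; first by exists 0%N.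
have [M hM] := IH (fun c cs => h c (mem_behead (s := b :: s) cs)).
have [M' hM'] := h b (mem_head _ _).
exists (M' + M)%N => x Qx c; rewrite inE => /orP[/eqP ->|cs].
  by rewrite addnC exprD -mulrA rpredM ?hM' // rpredX // natr_int.
by rewrite exprD -mulrA rpredM ?hM // rpredX // natr_int.
Qed.

(* At a coordinate b outside B0 lying below delta but above all smaller levels of
   B0, the integrality of the residue bounds the denominator of the coefficient
   at (delta, 0) in terms of those at the levels above delta. *)
Lemma bounded_denominators alpha (s : seq B) : ~ S alpha -> exists M, forall x,
  Aset x -> (forall b, (alpha <= b.1)%O -> coef b x != 0 -> b \in s) ->
  forall b, (alpha <= b.1)%O -> p%:R ^+ M * coef b x \is a Num.int.
Proof.
move=> nSa; pose Q x := Aset x /\ forall b, (alpha <= b.1)%O -> coef b x != 0 -> b \in s.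
have junk x b : Aset x -> S b.1 -> b.2 != 0%N -> coef b x = 0.
  by move=> [N hN] Sb; apply: ((hN N (leqnn N)).2 b Sb).2.
(* Induction on the number of coordinates of [s] above [delta], from the highest levels downwards.
   Elements of the group vanish at the coordinates of level [delta] other than [(delta, 0)]. *)
have top k delta : S delta -> (alpha <= delta)%O ->
    (count (fun b => delta < b.1)%O s < k)%N ->
    exists M, forall x, Q x -> p%:R ^+ M * coef (delta, 0%N) x \is a Num.int.
  elim: k delta => // k IH delta Sd ad dk.
  have [|M hM] := @uniform_denominator Q [seq b <- s | `[< S b.1 >] && (delta < b.1)%O].
    move=> [b1 b2]; rewrite mem_filter /= => /andP[/andP[/asboolP Sb db] bs].
    have [b20|b20] := eqVneq b2 0%N; last first.
      by exists 0%N => x [Ax _]; rewrite (junk x) // mulr0.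
    rewrite b20; apply: IH => //; first exact: le_trans ad (ltW db).
    move: dk; rewrite ltnS; apply: leq_trans; apply: (count_lt (x := (b1, b2))) => //=.
      by move=> c /=; exact: lt_trans.
    by rewrite ltxx.
  (* The level [c] is below [delta] but above [alpha] and all levels of [s] below [delta], so the
     fresh coordinate [b] taken above [c] is not in [s]. *)
  have [|c cd hc] := @limit_seq_bounded _ _ delta (alpha :: [seq b.1 | b <- s & (b.1 < delta)%O])
      (hSlim Sd).
    move=> e; rewrite inE => /orP[/eqP ->|/mapP[b]].
      by rewrite lt_neqAle ad andbT; apply/eqP => e'; apply: nSa; rewrite e'.
    by rewrite mem_filter => /andP[bd _] ->.
  have ac : (alpha < c)%O by apply: hc; exact: mem_head.
  have [b [cb bd nb [r [n0 hr]]]] := y_fresh Sd cd.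
  have gap e : e \in s -> (e.1 < delta)%O -> (e.1 < c)%O.
    move=> es ed; apply: hc; rewrite inE; apply/orP; right.
    by apply: map_f; rewrite mem_filter ed.
  exists (M + r)%N => x [Ax xs]; have [N hN] := Ax.
  pose n := maxn N n0; have [h1 h2] := hN n (leq_maxl _ _).
  have [k' hk'] := hr n (leq_maxr _ _).
  apply: (@int_cancel p _ k' n); last first.
    by rewrite mulrCA rpredM ?(h2 (delta, 0%N) Sd).1 // rpredX // natr_int.
  have bx : coef b x = 0.
    apply/eqP; apply: contrapT => /negP bx.
    have /gap := xs b (ltW (lt_trans ac cb)) bx.
    by move=> /(_ bd); rewrite ltNge (ltW cb).
  have := (h1 b).1; rewrite coef_residue // bx sub0r => h.
  have -> : p%:R ^+ (M + r) * coef (delta, 0%N) x * (1 + p%:R * k'%:~R) =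
      p%:R ^+ M * (coef (delta, 0%N) x * coef b (eta n delta)).
    by rewrite hk' exprD -!mulrA; congr (_ * _); rewrite mulrCA.
  have [d0|d0] := eqVneq (coef (delta, 0%N) x) 0; first by rewrite d0 mul0r mulr0.
  move: h; rewrite big_mkcond (bigD1_seq (delta, 0%N)) ?dom_uniq ?mem_dom //= asboolT //.
  set t := _ * _; set s' := \sum_(_ <- _ | _) _ => h.
  have -> : t = - (- (t + s')) - s' by rewrite opprK addrK.
  rewrite mulrBr rpredB //.
    by rewrite rpredM ?rpredX ?natr_int // rpredN.
  (* Levels up to that of [b] contribute nothing, since [eta] lies strictly below its level; the
     remaining ones are above [delta], where [M] bounds the denominators. *)
  rewrite /s' mulr_sumr rpred_sum // => e ed; case: asboolP => [Se|_]; last by rewrite mulr0.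
  have [->|ex] := eqVneq (coef e x) 0; first by rewrite mul0r mulr0.
  have [eb|be] := leP e.1 b.1.
    by rewrite (below_level_coef0 (@eta_below n _ Se) eb) !mulr0.
  have es : e \in s by apply: xs ex; exact/ltW/(lt_trans ac)/(lt_trans cb).
  rewrite mulrA rpredM ?(eta_lattice n Se b).1 //; apply: hM => //.
  rewrite mem_filter es asboolT //= andbT ltNge le_eqVlt; apply/negP => /orP[/eqP e1|/(gap _ es)].
    move: ed; case: e Se {es be} ex e1 => e1 e2 /= Se ex ed'; rewrite ed' xpair_eqE eqxx /=.
    by move=> e20; move: ex; rewrite (junk x) ?eqxx.
  by rewrite ltNge (ltW (lt_trans cb be)).
have [|M hM] := @uniform_denominator Q [seq b <- s | `[< S b.1 >] && (alpha <= b.1)%O].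
  move=> [b1 b2]; rewrite mem_filter /= => /andP[/andP[/asboolP Sb db] bs].
  have [->|b20] := eqVneq b2 0%N; first exact: top (leqnn _).
  by exists 0%N => x [Ax _]; rewrite (junk x) // mulr0.
exists M => x Ax xs b ab; have Qx : Q x by [].
have [->|bx] := eqVneq (coef b x) 0; first by rewrite mulr0.
have [Sb|nSb] := pselect (S b.1).
  by apply: hM => //; rewrite mem_filter ab asboolT //= xs.
(* At a coordinate outside [S] the coefficient is that of the integral residue plus integral
   multiples of coefficients at higher levels in [S]. *)
have [N hN] := Ax; have [h1 h2] := hN N (leqnn N).
have := (h1 b).1; rewrite coef_residue //; set s' := \sum_(_ <- _ | _) _ => h.
rewrite -[coef b x](subrK s') mulrDr rpredD //; first by rewrite rpredM ?rpredX ?natr_int.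
rewrite /s' mulr_sumr rpred_sum // => e /asboolP Se.
have [->|ex] := eqVneq (coef e x) 0; first by rewrite mul0r mulr0.
have [eb|be] := leP e.1 b.1.
  by rewrite (below_level_coef0 (@eta_below N _ Se) eb) !mulr0.
have ae : (alpha <= e.1)%O by exact/ltW/(le_lt_trans ab).
by rewrite mulrA rpredM ?(eta_lattice N Se b).1 // hM // mem_filter asboolT //= ae xs.
Qed.

(** * Extension of the retractions to the group *)

Hypothesis y_killed : forall delta mu, S delta -> (mu < delta)%O ->
  exists N, forall j, (N <= j)%N -> retract mu (y delta j) = 0.

(** For delta in [S] above [mu] the retraction kills almost all [y delta j], so the image of
    [unit (delta, 0)] can be chosen to make [zgen delta m] go to 0 for all large [m]; by [zgen_step]
    the other [zgen delta n] then go to integral vectors. *)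
Lemma Aset_retraction mu : exists r : {linear D -> D},
  (forall x, below_le mu x -> r x = x) /\
  (forall x, Aset x -> Aset (r x) /\ below_le mu (r x)).
Proof.
have [N hN] : exists N : W -> nat, forall delta, S delta -> (mu < delta)%O ->
    forall j, (N delta <= j)%N -> retract mu (y delta j) = 0.
  have /choice[N hN] : forall delta, exists N, S delta -> (mu < delta)%O ->
      forall j, (N <= j)%N -> retract mu (y delta j) = 0.
    move=> delta; have [[Sd md]|no] := pselect (S delta /\ (mu < delta)%O); last first.
      by exists 0%N => Sd md; case: no.
    by have [N hN] := y_killed Sd md; exists N.
  by exists N.
pose g b := if (b.1 <= mu)%O then unit b else
  if `[< S b.1 >] then - retract mu (eta (N b.1) b.1) else retract_gen mu b.
have gl b : below_le mu (g b).
  rewrite /g; case: ifP => [h|_]; first exact: below_le_unit.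
  case: asboolP => _; last exact: retract_gen_le.
  by rewrite -[- _]sub0r; apply: below_leB; [exact: below_le0|exact: retract_le].
have gid x : below_le mu x -> lift g x = x.
  by move=> h; rewrite -[RHS]lift_id; apply: eq_lift => b /h; rewrite /g => ->.
have gle x : below_le mu (lift g x).
  by apply: below_le_sum => b _; apply/below_leZ/gl.
have gL x : lattice x -> lift g x = retract mu x.
  move=> h; apply: eq_lift => b /(h b).2 nb; rewrite /g /retract_gen.
  by case: ifP => // h'; rewrite (asboolF nb) h'.
exists (lift g); split=> // x Ax; split; last exact: gle.
have [a xa] := exists_below_level x.
apply: (Aset_ind (P := fun x => Aset (lift g x)) (a := a)) Ax xa.
- by rewrite raddf0; exact: Aset0.
- by move=> z z'; rewrite raddfB; exact: AsetB.
- move=> b nb _; rewrite gL; last exact: lattice_unit.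
  by apply/lattice_Aset/retract_lattice/lattice_unit.
- move=> delta n Sd _; have [dm|md] := leP delta mu.
    rewrite gid; first exact: zgen_Aset.
    apply: below_leZ; rewrite -[eta _ _]opprK; apply: below_leB; first exact: below_le_unit.
    rewrite -[- _]sub0r; apply: below_leB; first exact: below_le0.
    by apply/below_level_le/(below_levelW dm)/eta_below.
  have zN m : (N delta <= m)%N -> lift g (zgen delta m) = 0.
    move=> Nm; rewrite /zgen linearZ linearD /= lift_unit /g /= leNgt md /= asboolT //.
    rewrite -/g gL; last exact: eta_lattice.
    have -> : eta m delta =
        eta (N delta) delta + \sum_(N delta <= j < m) p%:R ^+ j *: y delta j.
      by rewrite /eta (big_cat_nat (n := N delta) (p := m)).
    rewrite retractD addKr retract_sum big_nat big1 ?scaler0 // => j /andP[Nj _].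
    by rewrite retractZ hN // scaler0.
  have [l /(_ Sd) Ll ->] := zgen_step delta (leq_maxl n (N delta)).
  rewrite linearB linearZ /= zN ?leq_maxr // scaler0 gL //.
  apply: AsetB; first exact: Aset0.
  exact/lattice_Aset/retract_lattice.
Qed.

End WithY.
End Group.

(** * The filtration *)

Lemma sgvalB (A : zmodType) (B : zmodClosed A) (u v : subgroup B) :
  sgval (u - v) = sgval u - sgval v.
Proof. by []. Qed.

Lemma sgvalD (A : zmodType) (B : zmodClosed A) (u v : subgroup B) :
  sgval (u + v) = sgval u + sgval v.
Proof. by []. Qed.

Lemma sgvalMz (A : zmodType) (B : zmodClosed A) (u : subgroup B) (k : int) :
  sgval (u *~ k) = sgval u *~ k.
Proof. exact: (raddfMz (\val : subgroup B -> A)). Qed.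

Section QuotientMaps.
Context (A : zmodType) (B C : zmodClosed A).

Definition quotient_map (x : subgroup B) : quotient_group B C :=
  (\pi_(Quotient.quot (@Defs.restrict A B C)) x)%qT.

Lemma quotient_map_eq x y : quotient_map x = quotient_map y <-> sgval (x - y) \in C.
Proof.
have := Quotient.idealrBE (@Defs.restrict A B C) x y; rewrite inE /= => ->.
by split=> [/eqP|/eqP].
Qed.

Lemma quotient_mapB x y : quotient_map (x - y) = quotient_map x - quotient_map y.
Proof. exact: raddfB. Qed.

Lemma quotient_map0 : quotient_map 0 = 0.
Proof. exact: raddf0. Qed.

Lemma quotient_map_eq0 x : quotient_map x = 0 <-> sgval x \in C.
Proof. by rewrite -quotient_map0 quotient_map_eq subr0. Qed.

Lemma quotient_map_surj q : exists x, q = quotient_map x.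
Proof. by exists (repr q); rewrite /quotient_map reprK. Qed.

Lemma quotient_factor (V : zmodType) (f : {additive subgroup B -> V}) :
  (forall x, sgval x \in C -> f x = 0) ->
  exists g : {additive quotient_group B C -> V}, forall x, g (quotient_map x) = f x.
Proof.
move=> fC; pose g (q : quotient_group B C) := f (repr q).
have gpi x : g (quotient_map x) = f x.
  apply/eqP; rewrite -subr_eq0 -raddfB; apply/eqP/fC.
  by apply/quotient_map_eq; rewrite /quotient_map reprK.
have gB : {morph g : x y / x - y}.
  move=> q q'; have [x ->] := quotient_map_surj q; have [y ->] := quotient_map_surj q'.
  by rewrite -quotient_mapB !gpi raddfB.
pose m := GRing.isZmodMorphism.Build _ _ g gB.
pose g' : {additive quotient_group B C -> V} := HB.pack g m.
by exists g'.
Qed.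

End QuotientMaps.

Section MainGroup.
Context (d : Order.disp_t) (W : orderType d) (hW : is_omega1 W).
Context (S : set W) (hSlim : forall a, S a -> is_limit a) (p : nat) (hp : prime p).
Local Notation B := (W * nat)%type.
Local Notation D := (fsf B).
Implicit Types (a mu nu delta : W).

Lemma countable_coordinates a : countable [set b : B | (b.1 < a)%O].
Proof.
rewrite (_ : [set b : B | _] = below a `*` [set: nat]); last first.
  by apply/seteqP; split=> b //= [].
by apply: countableX => //; exact: countable_below hW a.
Qed.

Lemma countable_below_level a : countable [set x : D | below_level a x].
Proof.
pose X : set (B * rat) := [set b : B | (b.1 < a)%O] `*` [set: rat].
have cX : countable X by apply: countableX => //; exact: countable_coordinates.
have := countable_seq cX; apply: sub_countable.
pose ev (s : seq (B * rat)) : D := \sum_(c <- s) c.2 *: unit c.1.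
apply: card_le_trans (card_image_le ev _); apply: subset_card_le => x /= xa.
exists [seq (b, coef b x) | b <- dom x]; last by rewrite /ev big_map -fsf_sum.
move=> c /= /mapP[b]; rewrite mem_dom => /xa ba ->; split=> //.
Qed.

Lemma additive_of (G V : zmodType) (f : G -> V) :
  {morph f : x y / x - y} -> exists g : {additive G -> V}, g =1 f.
Proof.
move=> fB; pose m := GRing.isZmodMorphism.Build _ _ f fB.
pose g : {additive G -> V} := HB.pack f m.
by exists g.
Qed.

Variable code : B -> W * B.
Variable y : W -> nat -> D.
Hypothesis y_lattice : forall delta j, S delta -> lattice S (y delta j).
Hypothesis y_below : forall delta j, S delta -> below_level delta (y delta j).
Hypothesis y_fresh : forall delta nu, S delta -> (nu < delta)%O ->
  exists b, [/\ (nu < b.1)%O, (b.1 < delta)%O, ~ S b.1 &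
   exists r n0, forall n, (n0 <= n)%N ->
    exists k : int, coef b (eta p y n delta) = p%:R ^+ r * (1 + p%:R * k%:~R)].
Hypothesis y_killed : forall delta mu, S delta -> (mu < delta)%O ->
  exists N, forall j, (N <= j)%N -> retract S code mu (y delta j) = 0.
Local Notation inA := (Aset S p y).

Lemma zero_notin_S : exists2 z : W, is_zero z & ~ S z.
Proof. by have [z z0] := exists_zero hW; exists z => // /hSlim[]. Qed.

Lemma finite_codes (i : B -> nat) (P : set B) n : {in P &, injective i} ->
  exists s : seq B, forall b, P b -> (i b <= n)%N -> b \in s.
Proof.
move=> inj; elim: n => [|n [s hs]].
  have [[b Pb b0]|no] := pselect (exists2 b, P b & i b = 0%N); last first.
    by exists [::] => b Pb; rewrite leqn0 => /eqP b0; case: no; exists b.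
  exists [:: b] => c Pc; rewrite leqn0 => /eqP c0; rewrite inE; apply/eqP/inj; rewrite ?inE //.
  by rewrite c0.
have [[b Pb b0]|no] := pselect (exists2 b, P b & i b = n.+1); last first.
  exists s => b Pb; rewrite leq_eqVlt => /orP[/eqP b0|/hs]; last exact.
  by case: no; exists b.
exists (b :: s) => c Pc; rewrite inE leq_eqVlt => /orP[/eqP c0|/hs->//]; last by rewrite orbT.
by apply/orP; left; apply/eqP/inj; rewrite ?inE // c0.
Qed.

(** The freeness criterion for the coordinates at levels from [alpha] up to [beta], numbered by an
    injection [i]. When all later coordinates vanish, the support above [alpha] lies in a fixed
    finite list, and [bounded_denominators] applies. *)
Lemma free_of_coefs alpha beta (Q : zmodType) (c : B -> {additive Q -> rat}) : ~ S alpha ->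
  (forall q, exists x, [/\ inA x, below_level beta x &
     forall b, (alpha <= b.1)%O -> c b q = coef b x]) ->
  (forall q, (forall b, (alpha <= b.1)%O -> c b q = 0) -> q = 0) ->
  free_group Q.
Proof.
move=> nSa hc sep; have /countable_injP[i inj] := countable_coordinates beta.
pose dec n := pselect (exists b, [/\ (b.1 < beta)%O, (alpha <= b.1)%O & i b = n]).
(* Numbers that code no such coordinate get the zero map. *)
pose phi n : {additive Q -> rat} :=
  if dec n is left h then c (projT1 (cid h)) else [the {additive Q -> rat} of \0].
have phiE b q : (b.1 < beta)%O -> (alpha <= b.1)%O -> phi (i b) q = c b q.
  move=> bb ab; rewrite /phi; case: (dec _) => [h|[]]; last by exists b.
  by case: cid => b' /= [h1 h2 /inj ->]; rewrite ?inE.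
have phiP n : (forall q, phi n q = 0) \/
    exists b, [/\ (b.1 < beta)%O, (alpha <= b.1)%O, i b = n & forall q, phi n q = c b q].
  rewrite /phi; case: (dec _) => [h|_]; last by left.
  by right; case: cid => b /= [h1 h2 h3]; exists b.
apply: (free_criterion (phi := phi)) => [q|q h|n].
- have [x [_ _ xc]] := hc q; exists (\max_(b <- dom x) i b).+1 => k.
  have [->//|[b [h1 h2 <- ->]]] := phiP k; rewrite xc // ltnNge => ib.
  apply/eqP; apply: contraNT ib; rewrite -mem_dom => bx.
  exact: leq_bigmax_seq.
- apply: sep => b ab; have [x [_ xb xc]] := hc q.
  have [bb|bb] := ltP b.1 beta; first by rewrite -phiE.
  by rewrite xc // (below_level_coef0 xb).
- have [s hs] := finite_codes n inj.
  have [M hM] := bounded_denominators hSlim y_lattice y_below y_fresh s nSa.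
  exists (p ^ M)%N => [|q qn].
    by rewrite -lt0n expn_gt0 prime_gt0.
  have [->|[b [h1 h2 _ ->]]] := phiP n; first by rewrite mul0rn.
  have [x [Ax xb xc]] := hc q.
  rewrite xc // -mulr_natl natrX; apply: hM => // b' ab' bx.
  have b'b : (b'.1 < beta)%O by exact: xb.
  apply: hs => //; rewrite leqNgt; apply: contraNN bx => /qn.
  by rewrite phiE // xc // => ->.
Qed.

Variable AA : zmodClosed D.
Hypothesis hAA : forall x, x \in AA <-> inA x.
Local Notation A := (subgroup AA).
Variable F : W -> zmodClosed A.
Hypothesis hF : forall a (x : A), x \in F a <-> below_level a (sgval x).

Lemma group_inA (x : A) : inA (sgval x).
Proof. by apply/hAA; exact: valP. Qed.

Lemma countable_F a : countable [set` F a].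
Proof.
have /countable_injP[i inj] := countable_below_level a.
apply/countable_injP; exists (fun x => i (sgval x)) => u v /set_mem/= /hF ua /set_mem/= /hF va.
by move=> /inj e; apply/val_inj/e; rewrite inE.
Qed.

Lemma countable_sub_F (X : set A) : countable X -> exists a, X `<=` [set` F a].
Proof.
move=> cX; have /choice[l hl] : forall x : A, exists a, below_level a (sgval x).
  by move=> x; exact: (exists_below_level hW).
have [b hb] := countable_bounded hW (sub_countable (card_image_le l X) cX).
exists b => x Xx /=; apply/hF; apply: below_levelW (hl x).
by apply/ltW/hb; exists x.
Qed.

Lemma subF_succ a : exists2 b : W, is_succ a b & [set` F a] `<=` [set` F b].
Proof.
have [b ab] := exists_succ hW a; exists b => // x /= /hF xa.
by apply/hF/(below_levelW (ltW ab.1)).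
Qed.

(** The case where [alpha] is the least level, which is outside [S] because 0 is not a limit. *)
Lemma free_F a : free_group (subgroup (F a)).
Proof.
have [z z0 nSz] := zero_notin_S.
have /choice[c hc] : forall b : B, exists c : {additive subgroup (F a) -> rat},
    c =1 (fun x => coef b (sgval (sgval x))).
  move=> b; apply: (additive_of (f := fun x : subgroup (F a) => coef b (sgval (sgval x)))).
  by move=> u v; rewrite !sgvalB coefB.
apply: (free_of_coefs (alpha := z) (beta := a) (c := c)) => // [q|q h].
  exists (sgval (sgval q)); split; first exact: group_inA.
    by apply/hF; exact: valP.
  by move=> b _; rewrite hc.
apply/val_inj/val_inj/fsf_eqP => b.
by rewrite -[LHS]hc h.
Qed.

(** Coordinates at levels from [alpha] upwards vanish on [F alpha], hence are defined on the
    quotient, and they separate its points. The groups [G] and [K] may come from another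
    filtration. *)
Lemma free_quotient alpha (K G : zmodClosed A) : ~ S alpha -> countable [set` G] ->
  [set` K] = [set` F alpha] -> free_group (quotient_group G K).
Proof.
move=> nSa cG KF; have inK x : (x \in K) <-> below_level alpha (sgval x).
  by split=> h; [apply/hF|move/hF: h => h]; have : [set` K] x; rewrite ?KF // -?KF.
have [beta Gb] := countable_sub_F cG.
have qc (b : B) : exists c : {additive quotient_group G K -> rat},
    (alpha <= b.1)%O -> forall x, c (quotient_map _ x) = coef b (sgval (sgval x)).
  have [ab|ba] := boolP (alpha <= b.1)%O; last first.
    by exists [the {additive quotient_group G K -> rat} of \0].
  have [|g hg] := @additive_of (subgroup G) rat (fun x => coef b (sgval (sgval x))).
    by move=> u v; rewrite !sgvalB coefB.
  have [|c hc] := @quotient_factor _ _ K _ g.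
    by move=> x /inK xa; rewrite hg (below_level_coef0 xa).
  by exists c => _ x; rewrite hc hg.
have /choice[c hc] := qc.
apply: (free_of_coefs (alpha := alpha) (beta := beta) (c := c)) => // q;
  have [x ->] := quotient_map_surj q.
  exists (sgval (sgval x)); split; first exact: group_inA.
    by apply/hF/Gb; exact: valP.
  by move=> b ab; rewrite hc.
move=> h; apply/quotient_map_eq0/inK => b; rewrite ltNge; apply: contraNN => ab.
by rewrite -(hc b ab) h.
Qed.

(** The complement is the kernel of the extended retraction on [A]. *)
Lemma summand_F a (b : W) : is_succ a b -> direct_summand (F b).
Proof.
move=> ab; have leE (x : D) : below_le a x <-> below_level b x.
  by split=> h c /h; rewrite (succ_lt c.1 ab).
have [r [rid rA]] := Aset_retraction hW hp y_lattice y_below y_killed a.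
pose K (x : A) := r (sgval x) = 0.
have [||C hC] := @zmodClosed_of A K.
- by rewrite /K linear0.
- by move=> u v hu hv; rewrite /K sgvalB linearB hu hv subrr.
exists C; split=> [x /hF/leE xb /hC xK|x].
  by apply: val_inj; rewrite -[LHS]rid.
have [/hAA rxA rxa] := rA _ (group_inA x).
pose u : A := Subgroup rxA.
exists u, (x - u); split; last by rewrite addrC subrK.
  exact/hF/leE.
by apply/hC; rewrite /K sgvalB linearB /= [X in _ - X]rid // subrr.
Qed.

Lemma summand_free_F a (b : W) : is_succ a b -> countable_free_summand (F b).
Proof. by move=> ab; split; [exact: countable_F|exact: free_F|exact: summand_F ab]. Qed.

Lemma separable_A : aleph1_separable A.
Proof.
move=> X /countable_sub_F[a Xa]; have [b ab Fab] := subF_succ a.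
by exists (F b); split; [exact: subset_trans Fab|exact: summand_free_F ab].
Qed.

Lemma limit_below_level a (x : D) : is_limit a -> below_level a x ->
  exists2 c, (c < a)%O & below_level c x.
Proof.
move=> la xa; have [|c ca hc] := @limit_seq_bounded _ W a [seq b.1 | b <- dom x] la.
  by move=> _ /mapP[b + ->]; rewrite mem_dom => /xa.
by exists c => // b bx; apply: hc; apply: map_f; rewrite mem_dom.
Qed.

Lemma filtration_F : filtration F.
Proof.
split.
- by move=> a b ab x /= /hF/(below_levelW ab)/hF.
- move=> a la; apply/seteqP; split=> x /=.
    by move=> /hF/(limit_below_level la)[c ca xc]; exists c => //=; exact/hF.
  by move=> [c /= ca /hF]/(below_levelW (ltW ca))/hF.
- move=> a a0; apply/seteqP; split=> x /= => [/hF xa|->]; last exact: rpred0.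
  apply/val_inj/fsf_eqP => b; apply/eqP; apply: contrapT => /negP/xa.
  by rewrite ltNge a0.
- apply/seteqP; split=> // x _; have [a xa] := exists_below_level hW (sgval x).
  by exists a => //=; apply/hF.
- exact: summand_free_F.
Qed.

(** * The quotients at levels of [S] and the invariant [Gamma] *)

Definition zgenA delta n (hd : S delta) : A :=
  Subgroup (proj2 (hAA _) (zgen_Aset hp y_lattice n hd)).

Lemma zgen_belowF delta (b : W) n (hd : S delta) : is_succ delta b -> zgenA n hd \in F b.
Proof.
move=> db; apply/hF; apply: below_levelZ; apply: below_levelD.
  by apply: below_level_unit; exact: db.1.
apply: below_levelW (ltW db.1) _; exact: (eta_below y_below).
Qed.

(** Modulo [F delta] the elements [zgen delta n] and [p ^ k zgen(delta, n + k)] coincide. *)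
Lemma zgenA_divisible delta (V : zmodType) (f : {additive A -> V}) (hd : S delta) n k :
  (forall x, x \in F delta -> f x = 0) -> f (zgenA n hd) = f (zgenA (n + k) hd) *+ p ^ k.
Proof.
move=> fF; rewrite -raddfMn; apply/eqP; rewrite -subr_eq0 -raddfB; apply/eqP/fF/hF.
have nk : (n <= n + k)%N by exact: leq_addr.
have p0 : p%:R != 0 :> rat by rewrite pnatr_eq0 -lt0n prime_gt0.
have -> : sgval (zgenA n hd - zgenA (n + k) hd *+ p ^ k) =
    (p%:R ^+ n)^-1 *: (eta p y n delta - eta p y (n + k) delta).
  have -> : sgval (zgenA n hd - zgenA (n + k) hd *+ p ^ k) =
      zgen p y delta n - p%:R ^+ k *: zgen p y delta (n + k).
    rewrite -natrX scaler_nat; congr (_ - _).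
    by elim: (p ^ k)%N => // m IH; rewrite !mulrS -IH.
  apply: (scalerI (expf_neq0 n p0)); rewrite scalerBr zgenE // scalerA -exprD zgenE //.
  by rewrite scalerA divff ?expf_neq0 // scale1r opprD addrACA subrr add0r.
by apply/below_levelZ/below_levelB; exact: (eta_below y_below).
Qed.

(** As [G1] may miss the elements [zgen], they are projected to it. Their images in a free quotient
    are infinitely p-divisible, hence 0, which puts the projections in [F delta]. The complementary
    parts are p-divisible in the free group of the next level, hence 0 as well, and [zgen delta 0]
    would lie in [F delta]. *)
Lemma quotient_nonfree delta (G0 G1 : zmodClosed A) : S delta -> direct_summand G1 ->
  [set` G0] = [set` F delta] -> [set` F delta] `<=` [set` G1] ->
  ~ free_group (quotient_group G1 G0).
Proof.
move=> hd [C [C0 Cd]] G0F FG1 fr.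
have /choice[t ht] : forall x, exists b, b \in G1 /\ x - b \in C.
  by move=> x; have [b [c [h1 h2 ->]]] := Cd x; exists b; split=> //; rewrite addrC addKr.
have tu x b : b \in G1 -> x - b \in C -> t x = b.
  move=> bG bC; apply/eqP; rewrite -subr_eq0; apply/eqP/C0; first by rewrite rpredB // (ht x).1.
  have -> : t x - b = (x - b) - (x - t x) by rewrite opprB [RHS]addrC addrA subrK.
  by apply: rpredB => //; exact: (ht x).2.
have tB : {morph t : x y / x - y}.
  move=> u v; apply: tu; first by rewrite rpredB ?(ht _).1.
  have -> : u - v - (t u - t v) = (u - t u) - (v - t v).
    by rewrite !opprD !opprK addrACA.
  by apply: rpredB; exact: (ht _).2.
have tF x : x \in F delta -> t x = x.
  by move=> xF; apply: tu; [exact: FG1|rewrite subrr rpred0].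
pose q x : quotient_group G1 G0 := quotient_map G0 (Subgroup (ht x).1).
have [|q' hq'] := @additive_of _ _ q.
  move=> u v; rewrite /q -quotient_mapB; congr quotient_map; apply: val_inj; exact: tB.
have inG0 x : (x \in G0) = (x \in F delta).
  by apply/idP/idP => h; have : [set` G0] x; rewrite ?G0F // -?G0F.
have p1 : (1 < p)%N by exact: prime_gt1.
have tz n : t (zgenA n hd) \in F delta.
  rewrite -inG0; apply/(@quotient_map_eq0 _ _ G0 (Subgroup (ht (zgenA n hd)).1)).
  apply: (free_not_divisible p1 fr) => k; exists (q (zgenA (n + k) hd)).
  rewrite -[LHS]hq' -hq'; apply: zgenA_divisible => x xF.
  by rewrite hq'; apply/quotient_map_eq0; rewrite /= tF // inG0.
have [b db] := exists_succ hW delta.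
have FF x : x \in F delta -> x \in F b by move=> /hF/(below_levelW (ltW db.1))/hF.
have [|t' ht'] := @additive_of _ _ (fun x => x - t x).
  by move=> u v; rewrite tB !opprD !opprK addrACA.
have vF n : zgenA n hd - t (zgenA n hd) \in F b.
  by apply: rpredB; [exact: zgen_belowF|exact/FF/tz].
have v0 : Subgroup (vF 0%N) = 0.
  apply: (free_not_divisible p1 (free_F b)) => k; exists (Subgroup (vF k)).
  apply: val_inj; rewrite raddfMn /= -!ht' -[in RHS](add0n k).
  by apply: zgenA_divisible => x xF; rewrite ht' tF // subrr.
have : zgenA 0 hd \in F delta.
  by have /eqP := congr1 (@sgval _ _) v0; rewrite subr_eq0 => /eqP ->.
move=> /hF h; have : coef (delta, 0%N) (zgen p y delta 0) = 0.
  by apply: (below_level_coef0 h); rewrite /= lexx.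
by rewrite /zgen coefZ coefD coef_unit eqxx /eta big_geq // expr0 invr1 mul1r coef0 addr0.
Qed.

Lemma nonfree_limits_F : nonfree_limits F = S.
Proof.
apply/seteqP; split=> a.
  move=> [la [b ab nf]]; apply: contrapT => nSa; apply: nf; apply: free_quotient nSa _ _ => //.
  exact: countable_F.
move=> Sa; split; first exact: hSlim.
have [b ab] := exists_succ hW a; exists b => //.
apply: (quotient_nonfree (delta := a)) => //; first exact: summand_F ab.
by move=> x /= /hF/(below_levelW (ltW ab.1))/hF.
Qed.

(** Two filtrations agree on the club of limits closed under a function [f] that interleaves them;
    there [free_quotient] and [quotient_nonfree] decide the quotients of the other filtration. *)
Lemma Gamma_A : Gamma W A = club_class S.
Proof.
apply/seteqP; split=> T.
  move=> [G fG TG]; apply: (club_equiv_trans hW TG).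
  have cG a : countable [set` G a].
    have [b ab] := exists_succ hW a; have [cGb _ _] := filtration_succ fG ab.
    apply: sub_countable cGb; apply: subset_card_le; exact: filtration_increasing (ltW ab.1).
  have /choice[l hl] : forall x : A, exists a, x \in G a.
    by move=> x; have : [set: A] x by []; rewrite -(filtration_union fG) => -[a _ xa]; exists a.
  have /choice[f hf] : forall b : W, exists c : W,
      [set` F b] `<=` [set` G c] /\ [set` G b] `<=` [set` F c].
    move=> b; have [c1 hc1] := countable_sub_F (cG b).
    have [c2 hc2] := countable_bounded hW (sub_countable (card_image_le l [set` F b]) (countable_F b)).
    exists (Order.max c1 c2); split=> x xb /=.
      apply: (filtration_increasing fG) (hl x); apply: le_trans (_ : c2 <= _)%O.
        by apply/ltW/hc2; exists x.
      by rewrite le_max lexx orbT.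
    by apply/hF/(below_levelW _ (proj1 (hF _ _) (hc1 x xb))); rewrite le_max lexx.
  exists [set a | is_limit a /\ forall b, (b < a)%O -> (f b < a)%O].
    exact: closure_club hW f.
  have GF a : is_limit a -> (forall b, (b < a)%O -> (f b < a)%O) -> [set` G a] = [set` F a].
    move=> la fa; apply/seteqP; split=> x.
      rewrite (filtration_continuous fG la) => -[b ba /(proj2 (hf b)) xb].
      exact: (filtration_increasing filtration_F (ltW (fa b ba))).
    rewrite (filtration_continuous filtration_F la) => -[b ba /(proj1 (hf b)) xb].
    exact: (filtration_increasing fG (ltW (fa b ba))).
  apply/seteqP; split=> a [h [la fa]]; split=> //.
    case: h => _ [b ab nf]; apply: contrapT => nSa; apply: nf.
    by apply: (free_quotient nSa); [exact: cG|exact: GF].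
  split=> //; have [b ab] := exists_succ hW a; exists b => //.
  have [_ _ sGb] := filtration_succ fG ab.
  apply: (quotient_nonfree (delta := a)) => //; first exact: GF.
  by rewrite -GF //; exact: (filtration_increasing fG (ltW ab.1)).
move=> TS; exists F; first exact: filtration_F.
by rewrite nonfree_limits_F.
Qed.

(** * Quotient type and cardinality *)

Lemma Qp_memP (q : rat) : q \in Qp_pred p <-> exists n, p%:R ^+ n * q \is a Num.int.
Proof.
split=> [|[n /intrP[k hk]]].
  rewrite inE => /part_pnat_id; rewrite p_part => dq.
  exists (logn p `|denq q|); rewrite -natrX dq mulrC.
  have := denq_gt0 q => d0; rewrite -[`|denq q|%N%:R]/(`|denq q|%N%:~R) gez0_abs; last exact: ltW.
  by rewrite -{1}[q]divq_num_den divfK ?intr_int // intr_eq0 denq_neq0.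
rewrite inE; apply: (@pnat_dvd _ (p ^ n)%N); last by rewrite pnatX pnat_id // orbC.
have p0 : p%:R != 0 :> rat by rewrite pnatr_eq0 -lt0n prime_gt0.
have E : q = k%:~R / (Posz (p ^ n))%:~R.
  by rewrite -hk -[(Posz _)%:~R]/((p ^ n)%N%:R) natrX mulrC mulKf // expf_neq0.
have m0 : Posz (p ^ n) != 0 by rewrite -lt0n expn_gt0 prime_gt0.
rewrite E -[(p ^ n)%N in X in (_ %| X)%N]/`|Posz (p ^ n)|%N.
move: (Posz (p ^ n)) m0 => m m0.
case: divqP m0 => [|k' z _ _]; first by rewrite eqxx.
by rewrite abszM dvdn_mull.
Qed.

(** The isomorphism is the coefficient at [(delta, 0)], the only coordinate of level [delta] that
    occurs in the group; it takes the value [p ^ (-n)] at [zgen delta n], which gives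
    surjectivity. *)
Lemma quotient_F_Qp delta (b : W) : S delta -> is_succ delta b ->
  isomorphic (quotient_group (F b) (F delta)) (Qp p).
Proof.
move=> hd db.
have inQp (x : A) : coef (delta, 0%N) (sgval x) \in Qp_pred p.
  have [N hN] := group_inA x; apply/Qp_memP; exists N.
  exact: ((hN N (leqnn N)).2 (delta, 0%N) hd).1.
have [|f hf] := @additive_of (subgroup (F b)) (Qp p) (fun x => Subgroup (inQp (sgval x))).
  move=> u v; apply: val_inj; rewrite [RHS](sgvalB (Subgroup _) (Subgroup _)).
  exact: (coefB (delta, 0%N) (sgval (sgval u)) (sgval (sgval v))).
have [|g hg] := @quotient_factor _ _ (F delta) _ f.
  by move=> x /hF xd; rewrite hf; apply: val_inj; rewrite /= (below_level_coef0 xd).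
exists g.
have g0 w : g w = 0 -> w = 0.
  have [x ->] := quotient_map_surj w; rewrite hg hf => /(congr1 (@sgval _ _)) /= x0.
  apply/quotient_map_eq0/hF => c cx.
  have : (c.1 < b)%O by move/hF: (valP x); apply.
  rewrite (succ_lt c.1 db) le_eqVlt => /orP[/eqP cd|//].
  have [N hN] := group_inA (sgval x).
  have c2 : c.2 != 0%N.
    apply: contra cx => /eqP c20; have -> : c = (delta, 0%N) by rewrite -cd -c20; case: (c).
    exact/eqP.
  have Sc : S c.1 by rewrite cd.
  by move: cx; rewrite (((hN N (leqnn N)).2 c Sc).2 c2) eqxx.
have ginj : injective g.
  by move=> u v e; apply/eqP; rewrite -subr_eq0; apply/eqP/g0; rewrite raddfB e subrr.
have gsurj q : exists u, g u = q.
  have /Qp_memP[n /intrP[k hk]] := valP q.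
  have zF : zgenA n hd *~ k \in F b by rewrite rpredMz // zgen_belowF.
  exists (quotient_map _ (Subgroup zF)); rewrite hg hf; apply: val_inj.
  rewrite /= sgvalMz coefMz /zgen coefZ coefD coef_unit eqxx.
  rewrite (below_level_coef0 (eta_below y_below hd (n := n))) ?lexx // addr0 mulr1 -mulrzr -hk.
  by rewrite mulKf // expf_neq0 // pnatr_eq0 -lt0n prime_gt0.
have [h hK] := choice gsurj.
by exists h => // u; apply: ginj; rewrite hK.
Qed.

Lemma unit_Aset (a : W) : inA (unit (a, 0%N)).
Proof.
have [Sa|nSa] := pselect (S a); last exact/lattice_Aset/lattice_unit.
have := zgen_Aset hp y_lattice 0 Sa.
by rewrite /zgen /eta big_geq // expr0 invr1 scale1r addr0.
Qed.

Lemma card_A : ([set: A] #= [set: W])%card.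
Proof.
apply: Cantor_Bernstein.
  have [|k kinj] := omega1_injection hW countable_F.
    by move=> x; have [a xa] := exists_below_level hW (sgval x); exists a; apply/hF.
  have [_ h] := (card_eqPle _ _).1 (inj_card_eq (in2W kinj : {in [set: A] &, injective k})).
  exact: card_le_trans h (subset_card_le (@subsetT _ _)).
pose e (a : W) : A := Subgroup (proj2 (hAA _) (unit_Aset a)).
have einj : injective e.
  move=> a a' eaa; have : coef (a, 0%N) (unit (a, 0%N)) = coef (a, 0%N) (unit (a', 0%N)).
    exact: (congr1 (fun x => coef (a, 0%N) (sgval x)) eaa).
  by rewrite !coef_unit eqxx; case: eqP => [[]|].
have [_ h] := (card_eqPle _ _).1 (inj_card_eq (in2W einj : {in [set: W] &, injective e})).
exact: card_le_trans h (subset_card_le (@subsetT _ _)).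
Qed.

End MainGroup.

(** * Choice of the sequences y *)

Lemma countable_enum (T : Type) (X : set T) x0 : countable X -> X x0 ->
  exists e : nat -> T, (forall n, X (e n)) /\ forall x, X x -> exists n, e n = x.
Proof.
move=> /countable_injP[f finj] X0.
have /choice[e he] : forall n, exists x, X x /\ ((exists2 x', X x' & f x' = n) -> f x = n).
  move=> n; have [[x Xx fx]|no] := pselect (exists2 x', X x' & f x' = n).
    by exists x.
  by exists x0; split=> // h; case: no.
exists e; split=> [n|x Xx]; first exact: (he n).1.
exists (f x); apply: finj; rewrite ?inE //; first exact: (he _).1.
by apply: (he _).2; exists x.
Qed.

(** If [p ^ N t = q], then [p ^ M q] is a nonzero integral multiple of [p ^ N]; with its own
    absolute value as [N] this contradicts N < p^N. *)
Lemma not_p_divisible (p : nat) (q : rat) (M : nat) : (1 < p)%N -> q != 0 ->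
  exists N, forall t : rat, p%:R ^+ M * t \is a Num.int -> p%:R ^+ N * t != q.
Proof.
move=> p1 q0; have p0 : p%:R != 0 :> rat by rewrite pnatr_eq0 -lt0n ltnW.
exists `|numq (p%:R ^+ M * q)|%N => t /intrP[z hz]; apply/eqP; set N := `|_|%N => hq.
have E : p%:R ^+ M * q = (z * (Posz (p ^ N)))%:~R.
  rewrite -hq mulrCA hz rmorphM /= mulrC; congr (_ * _).
  by rewrite -[RHS]/((p ^ N)%N%:R) natrX.
have z0 : z != 0.
  apply: contraNneq q0 => z0; move/eqP: E; rewrite z0 mul0r mulf_eq0 expf_eq0 (negPf p0) andbF.
  by [].
have : N = (`|z| * p ^ N)%N by rewrite {1}/N E numq_int abszM.
have : (N < p ^ N)%N by exact: ltn_expl.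
have : (0 < `|z|)%N by rewrite absz_gt0.
move=> h1 h2 h3; have := leq_pmull (p ^ N) h1; rewrite -h3 leqNgt h2.
by [].
Qed.

Lemma one_addM_mul (R : comPzRingType) (q a b : R) :
  (1 + q * a) * (1 + q * b) = 1 + q * (b + a + q * b * a).
Proof.
rewrite mulrDl mul1r [X in _ + X]mulrDr mulr1 !(mulrDr q) !addrA; congr (_ + _).
by rewrite -!mulrA; congr (_ * _); rewrite mulrCA [b * a]mulrC.
Qed.

Section Diagonal.
Context (d : Order.disp_t) (W : orderType d) (hW : is_omega1 W).
Context (S : set W) (hSlim : forall a, S a -> is_limit a) (p : nat) (hp : prime p).
Local Notation B := (W * nat)%type.
Local Notation D := (fsf B).
Implicit Types (a mu nu delta : W).
Variable code : B -> W * B.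
Hypothesis code_surj : forall nu mu (c : B), (c.1 <= mu)%O -> (mu <= nu)%O ->
  exists k, code (nu, k) = (mu, c).
Local Notation rho := (retract S code).

(** The property of a projection that no finite set of retractions controls, restricted to vectors
    below [delta]. *)
Definition good delta (f : D -> D) := forall s : seq W, (forall mu, mu \in s -> (mu < delta)%O) ->
  exists w, [/\ lattice S w, below_level delta w, (forall mu, mu \in s -> rho mu w = 0) & f w != 0].

(** The conditions on [y delta] under which the group is separable with the right quotients, for a
    single [delta] and a single sequence. *)
Definition admissible delta (t : nat -> D) := [/\ forall j, lattice S (t j),
  forall j, below_level delta (t j),
  (forall nu, (nu < delta)%O ->
    exists b : B, [/\ (nu < b.1)%O, (b.1 < delta)%O, ~ S b.1 &
     exists r n0, forall n, (n0 <= n)%N ->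
      exists k : int, coef b (\sum_(0 <= j < n) p%:R ^+ j *: t j) = p%:R ^+ r * (1 + p%:R * k%:~R)]) &
  (forall mu, (mu < delta)%O -> exists N, forall j, (N <= j)%N -> rho mu (t j) = 0)].

(* One step in the construction of y delta: sigma is the sum of the p ^ i y_i for
   i < j, below level a; y is divisible by p ^ N, and from now on the terms will be
   divisible by p ^ N', which keeps h j from becoming the value at zgen delta 0. *)
Record step delta (f : D -> D) (G : set D) (e : nat -> W) (h : nat -> D)
    j (sigma : D) (N : nat) (a : W) (y : D) (N' : nat) (a' : W) : Prop := Step {
  step_level : (a' < delta)%O;
  step_below : below_level a' (sigma + p%:R ^+ j *: y);
  step_div : exists2 y0, lattice S y0 /\ below_level delta y0 & y = p%:R ^+ N *: y0;
  step_killed : forall i, (i <= j)%N -> rho (e i) y = 0;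
  step_fresh : exists b : B, [/\ forall i, (i <= j)%N -> (e i < b.1)%O, (b.1 < delta)%O, ~ S b.1,
    (a <= b.1)%O & exists k : int, coef b y = p%:R ^+ N * (1 + p%:R * k%:~R)];
  step_N : (N <= N')%N;
  step_diag : forall g, G g -> p%:R ^+ N' *: g <> h j + f (sigma + p%:R ^+ j *: y) }.

(** Start from a vector [w] with [f w] nonzero, add a multiple of a fresh generator, and scale. Both
    changes use factors [1 + p k], which keep the fresh coefficient in the required form, and each
    avoids a zero by taking [k] to be 0 or 1. Then [N'] exists since no nonzero vector is divisible
    in [G] by all powers of [p]. *)
Lemma exists_step delta (f : {linear D -> D}) (G : set D) e h j sigma N a :
  S delta -> good delta f ->
  (forall x : D, x != 0 -> exists n, forall g, G g -> p%:R ^+ n *: g <> x) ->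
  (forall g k, G g -> G (p%:R ^+ k *: g)) ->
  (forall n, (e n < delta)%O) -> (a < delta)%O -> below_level a sigma ->
  exists t : D * nat * W, step delta f G e h j sigma N a t.1.1 t.1.2 t.2.
Proof.
move=> Sd gf haus GZ ed ad sa; have ld := hSlim Sd.
have p1 : (1 < p)%N by exact: prime_gt1.
have p0 : p%:R != 0 :> rat by rewrite pnatr_eq0 -lt0n prime_gt0.
pose s := [seq e i | i <- iota 0 j.+1].
have es i : (i <= j)%N -> e i \in s by move=> ij; apply: map_f; rewrite mem_iota.
have [w [Lw wd kw fw]] : exists w, [/\ lattice S w, below_level delta w,
    (forall mu, mu \in s -> rho mu w = 0) & f w != 0].
  by apply: gf => mu /mapP[i _ ->].
have [c0 c0d wc0] := limit_below_level ld wd.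
have [|c cd hc] := @limit_seq_bounded _ W delta [:: a, c0 & s] ld.
  move=> x; rewrite inE => /orP[/eqP->//|]; rewrite inE => /orP[/eqP->//|].
  by move=> /mapP[i _ ->].
(* A successor is outside [S], so the generators of level [nu] are integral vectors. *)
have [nu cnu] := exists_succ hW c.
have nud : (nu < delta)%O by exact: limit_succ ld cnu cd.
have nunS : ~ S nu by move=> /hSlim; exact: succ_not_limit cnu.
have [b bnu kb] := exists_killed code_surj nunS.
have cb0 : coef b w = 0.
  apply: (below_level_coef0 wc0); rewrite bnu; apply/ltW/(lt_trans _ cnu.1)/hc.
  by rewrite !inE eqxx orbT.
(* The candidates [x + v] and [x + (1 + p) v] differ by [p v], so they are not both 0. *)
have unitc (x v : D) : v != 0 -> exists k : int, x + (1 + p%:R * k%:~R) *: v != 0.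
  move=> v0; have [x0|] := eqVneq (x + v) 0; last by exists 0; rewrite mulr0 addr0 scale1r.
  exists 1; rewrite mulr1 scalerDl scale1r addrA x0 add0r.
  by rewrite scaler_eq0 negb_or p0.
have [k1 fw'] : exists k : int, f (w + (1 + p%:R * k%:~R) *: unit b) != 0.
  have [u0|/(unitc (f w))[k hk]] := eqVneq (f (unit b)) 0.
    by exists 0; rewrite mulr0 addr0 scale1r linearD u0 addr0.
  by exists k; rewrite linearD linearZ.
set w' := w + _ in fw'.
have Lz (k : int) x : lattice S x -> lattice S ((1 + p%:R * k%:~R) *: x).
  move=> Lx; have -> : 1 + p%:R * k%:~R = (1 + p%:Z * k)%:~R :> rat by rewrite rmorphD rmorphM.
  by rewrite scaler_int; exact: latticeMz.
have Lw' : lattice S w'.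
  apply: latticeD => //.
  by apply: Lz; apply: lattice_unit; rewrite bnu.
have [a' nua'] := exists_succ hW nu.
have a'd : (a' < delta)%O by exact: limit_succ ld nua' nud.
have w'a : below_level a' w'.
  apply: below_levelD.
    apply: below_levelW wc0; apply/ltW/(lt_trans _ nua'.1)/(lt_trans _ cnu.1)/hc.
    by rewrite !inE eqxx orbT.
  by apply/below_levelZ/below_level_unit; rewrite bnu; exact: nua'.1.
have [k2 hk2] : exists k : int,
    h j + f sigma + (1 + p%:R * k%:~R) *: (p%:R ^+ j *: (p%:R ^+ N *: f w')) != 0.
  by apply: unitc; rewrite !scaler_eq0 !expf_eq0 !(negPf p0) !andbF.
pose y0 := (1 + p%:R * k2%:~R) *: w'.
pose y : D := p%:R ^+ N *: y0.
have hfE : h j + f (sigma + p%:R ^+ j *: y) =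
    h j + f sigma + (1 + p%:R * k2%:~R) *: (p%:R ^+ j *: (p%:R ^+ N *: f w')).
  rewrite linearD /y /y0 !linearZ /= addrA; congr (_ + _).
have [N' hN'] := haus _ hk2.
have sc mu : mu \in s -> (mu < nu)%O.
  move=> ms; apply: lt_trans cnu.1; apply: hc.
  by rewrite inE; apply/orP; right; rewrite inE; apply/orP; right.
exists (y, maxn N N', a'); split=> //=.
- apply: below_levelD; last exact/below_levelZ/below_levelZ/below_levelZ.
  apply: below_levelW sa; apply/ltW/(lt_trans _ nua'.1)/(lt_trans _ cnu.1)/hc.
  by rewrite inE eqxx.
- exists y0 => //; split; first exact: Lz.
  by apply/below_levelZ/(below_levelW (ltW a'd)).
- move=> i /es ei; rewrite /y /y0 /w' !retractZ retractD retractZ kw // kb ?sc //.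
  by rewrite scaler0 addr0 !scaler0.
- exists b; rewrite bnu; split=> //; first by move=> i /es/sc.
    by apply/ltW/(lt_trans _ cnu.1)/hc; rewrite inE eqxx.
  exists (k1 + k2 + p%:Z * k1 * k2); rewrite /y /y0 /w' !coefZ coefD cb0 add0r coefZ coef_unit eqxx mulr1.
  by rewrite one_addM_mul !rmorphD !rmorphM.
- exact: leq_maxl.
- move=> g Gg; rewrite hfE -(subnKC (leq_maxr N N')) exprD -scalerA.
  exact/hN'/GZ.
Qed.

(** Iterate [exists_step] along enumerations [e] of the levels below [delta] and [h] of [G]. A
    possible [x] is some [h j], and step [j] rules it out, since the later terms are too divisible
    to interfere. *)
Lemma diagonal_sequence delta (f : {linear D -> D}) (G : set D) :
  S delta -> good delta f -> countable G ->
  (forall x x' : D, G x -> G x' -> G (x - x')) ->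
  (forall x, lattice S x -> below_level delta x -> G (f x)) ->
  (forall x : D, x != 0 -> exists n, forall g, G g -> p%:R ^+ n *: g <> x) ->
  exists t, admissible delta t /\ forall x, G x -> ~ forall n, exists2 g, G g &
    p%:R ^+ n *: g = x + f (\sum_(0 <= j < n) p%:R ^+ j *: t j).
Proof.
move=> Sd gf cG GB Gf haus; have ld := hSlim Sd.
have G0 : G 0.
  rewrite -(linear0 f); apply: Gf; [exact: lattice0|exact: below_level0].
have GZ g k : G g -> G (p%:R ^+ k *: g).
  by move=> Gg; rewrite -natrX scaler_nat -[_ *+ _]/(g *~ (p ^ k)%N); exact: closedMz.
have [a0 a0d] := limit_gt0 ld.
have [e [ed esurj]] := countable_enum (countable_below hW delta) a0d.
have [h [hG hsurj]] := countable_enum cG G0.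
have /choice[st hst] : forall q : nat * (D * nat * W), exists t : D * nat * W,
    (q.2.2 < delta)%O -> below_level q.2.2 q.2.1.1 ->
    step delta f G e h q.1 q.2.1.1 q.2.1.2 q.2.2 t.1.1 t.1.2 t.2.
  move=> [j [[sigma N] a]] /=.
  have [[ad sa]|no] := pselect ((a < delta)%O /\ below_level a sigma); last first.
    by exists (0, 0%N, a) => ad sa; case: no.
  have [t ht] := exists_step h j N Sd gf haus GZ ed ad sa.
  by exists t.
pose next j (q : D * nat * W) : D * nat * W :=
  let t := st (j, q) in (q.1.1 + p%:R ^+ j *: t.1.1, t.1.2, t.2).
pose q_ := fix q_ j : D * nat * W := if j is j'.+1 then next j' (q_ j') else (0, 1%N, a0).
have qok j : (let q := q_ j in (q.2 < delta)%O /\ below_level q.2 q.1.1).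
  elim: j => [|j /= [h1 h2]]; first by split=> //=; exact: below_level0.
  have := hst (j, q_ j) h1 h2; rewrite /= => hs.
  by split; [exact: (step_level hs)|exact: (step_below hs)].
pose t j := (st (j, q_ j)).1.1; pose N_ j := (q_ j).1.2.
have tok j : step delta f G e h j (q_ j).1.1 (N_ j) (q_ j).2 (t j) (N_ j.+1) (q_ j.+1).2.
  have [h1 h2] := qok j; exact: (hst (j, q_ j) h1 h2).
have qE n : (q_ n).1.1 = \sum_(0 <= j < n) p%:R ^+ j *: t j.
  elim: n => [|n IH]; first by rewrite big_geq.
  by rewrite big_nat_recr //= -IH.
have Nmono : {homo N_ : i j / (i <= j)%N}.
  by apply: homo_leq => // [|i]; [exact: leq_trans|exact: (step_N (tok i))].
(* the terms after the j-th are divisible by p ^ (N_ j.+1) *)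
have tail j n : (j < n)%N -> exists2 l, lattice S l /\ below_level delta l &
    \sum_(j.+1 <= i < n) p%:R ^+ i *: t i = p%:R ^+ (j.+1 + N_ j.+1) *: l.
  move=> jn; have /choice[l hl] : forall i, exists l, lattice S l /\ below_level delta l /\
      t i = p%:R ^+ (N_ i) *: l.
    by move=> i; have [l [l1 l2] l3] := step_div (tok i); exists l.
  exists (\sum_(j.+1 <= i < n) p%:R ^+ (i - j.+1 + (N_ i - N_ j.+1)) *: l i).
    split; first by apply: lattice_sum => i _; apply/latticeXn; exact: (hl i).1.
    by apply: below_level_sum => i _; apply: below_levelZ; exact: (hl i).2.1.
  rewrite scaler_sumr; apply: eq_big_nat => i /andP[ji _].
  rewrite (hl i).2.2 !scalerA -!exprD; congr (_ ^+ _ *: _).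
  by rewrite addnACA !subnKC // Nmono.
have split j n : (j < n)%N -> \sum_(0 <= i < n) p%:R ^+ i *: t i =
    (q_ j.+1).1.1 + \sum_(j.+1 <= i < n) p%:R ^+ i *: t i.
  by move=> jn; rewrite qE -(big_cat_nat (n := j.+1) (p := n)).
exists t; split.
  split=> [j|j|nu nud|mu mud].
  - by have [l [Ll _] ->] := step_div (tok j); exact: latticeXn.
  - by have [l [_ ld'] ->] := step_div (tok j); exact: below_levelZ.
  - have [j ej] := esurj nu nud.
    have [b [eb bd nb ab [k hk]]] := step_fresh (tok j).
    exists b; split=> //; first by rewrite -ej; exact: eb.
    (* The partial sum before [j] vanishes at [b], and the terms after [j] contribute a multiple of
       [p ^ (r + 1)], so the valuation settles at [r = j + N_ j]. *)
    exists (j + N_ j)%N, j.+1 => n jn; rewrite (split j) //.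
    have [l [Ll _] ->] := tail j n jn.
    have /intrP[z hz] := (Ll b).1.
    rewrite coefD coefZ hz /= coefD (below_level_coef0 (qok j).2 ab) add0r coefZ hk.
    exists (k + Posz (p ^ (N_ j.+1 - N_ j)) * z).
    have -> : (j.+1 + N_ j.+1 = j + N_ j + (N_ j.+1 - N_ j).+1)%N.
      by rewrite addnS -addnA subnKC ?Nmono.
    have -> : p%:R ^+ (j + N_ j + (N_ j.+1 - N_ j).+1) =
        p%:R ^+ (j + N_ j) * (p%:R * p%:R ^+ (N_ j.+1 - N_ j)) :> rat.
      by rewrite exprD exprS.
    rewrite mulrA -exprD -!mulrA -mulrDr.
    congr (_ * _); rewrite -addrA -mulrDr rmorphD rmorphM /=.
    by rewrite -[(Posz _)%:~R]/((p ^ (N_ j.+1 - N_ j))%N%:R) natrX.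
  - have [j ej] := esurj mu mud; exists j => i ji; rewrite -ej; exact: (step_killed (tok i)).
move=> x Gx hx; have [j hj] := hsurj x Gx.
(* With this exponent the tail after [j] is divisible by [p ^ n] and can be moved to the left, so
   [h j] plus the image of the first [j + 1] terms would be divisible by [p ^ N_ j.+1]. *)
pose n := (j.+1 + N_ j.+1)%N.
have jn : (j < n)%N by rewrite /n addSn ltnS leq_addr.
have [g Gg] := hx n; rewrite (split j) //.
have [l [Ll lb] ->] := tail j n jn => E.
apply: (step_diag (tok j) (g := p%:R ^+ j.+1 *: (g - f l))); first exact/GZ/GB/Gf.
rewrite hj scalerA -exprD addnC scalerBr E linearD linearZ /= addrA addrK.
reflexivity.
Qed.

(** With the identity as [f], [diagonal_sequence] yields an admissible sequence where nothing has to
    be obstructed. *)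
Lemma good_id delta : is_limit delta -> good delta id.
Proof.
move=> ld s sd; have [c cd hc] := limit_seq_bounded ld sd.
have [nu cnu] := exists_succ hW c.
have nunS : ~ S nu by move=> /hSlim; exact: succ_not_limit cnu.
have [b bnu kb] := exists_killed code_surj nunS.
exists (unit b); split.
- by apply: lattice_unit; rewrite bnu.
- by apply: below_level_unit; rewrite bnu; exact: limit_succ ld cnu cd.
- by move=> mu /hc h; apply: kb; exact: lt_trans cnu.1.
- apply/eqP => /(congr1 (coef b)); rewrite coef_unit eqxx coef0 => /eqP.
  by rewrite oner_eq0.
Qed.

Lemma exists_admissible delta : S delta -> exists t, admissible delta t.
Proof.
move=> Sd; pose G x := lattice S x /\ below_level delta x.
have idlin : linear (id : D -> D) by [].
pose m := GRing.isLinear.Build rat D D *:%R id idlin.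
pose f : {linear D -> D} := HB.pack (id : D -> D) m.
have [||||t [ht _]] := @diagonal_sequence delta f G Sd (good_id (hSlim Sd)); last by exists t.
- by apply: sub_countable (countable_below_level hW delta); apply: subset_card_le => x [].
- by move=> x x' [h1 h2] [h1' h2']; split; [exact: latticeB|exact: below_levelB].
- by [].
- move=> x x0; have [b bx] : exists b, coef b x != 0.
    apply: contrapT => no; move/eqP: x0; apply; apply: fsf_eqP => b; rewrite coef0.
    by apply/eqP; apply: contrapT => /negP h; apply: no; exists b.
  have [n hn] := not_p_divisible 0 (prime_gt1 hp) bx.
  exists n => g [Lg _] E; have := hn (coef b g); rewrite expr0 mul1r => /(_ (Lg b).1).
  by rewrite -coefZ E eqxx.
Qed.

(** * Recursive construction of all the sequences *)

Lemma Aset_local delta (y y' : W -> nat -> D) x :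
  (forall mu, (mu < delta)%O -> y mu = y' mu) -> below_level delta x ->
  Aset S p y x -> Aset S p y' x.
Proof.
move=> yy xd [N hN]; exists N => n /hN[h1 h2]; split=> //.
rewrite (_ : residue S p y' n x = residue S p y n x) //.
apply: eq_lift => b /xd bd; case: asboolP => // _.
by congr (- _); apply: eq_bigr => j _; rewrite yy.
Qed.

(** If [f] extended to a homomorphism with value [x] at [zgen delta 0], its value [g] at
    [zgen delta n] would satisfy this equation; so no extension takes values in the group below
    [delta]. *)
Definition obstructs delta (y : W -> nat -> D) (f : D -> D) (t : nat -> D) :=
  (forall x, lattice S x -> below_level delta x -> Aset S p y (f x) /\ below_level delta (f x)) ->
  good delta f ->
  forall x, Aset S p y x -> below_level delta x ->
  ~ forall n, exists g, [/\ Aset S p y g, below_level delta g &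
    p%:R ^+ n *: g = x + f (\sum_(0 <= j < n) p%:R ^+ j *: t j)].

(** Recursion on [delta]: by [Aset_local] the conditions involve only the earlier sequences. *)
Lemma exists_obstructing (f : W -> {linear D -> D}) : exists y : W -> nat -> D,
  forall delta, S delta -> admissible delta (y delta) /\ obstructs delta y (f delta) (y delta).
Proof.
have [y0 hy0] : exists y0 : W -> nat -> D, forall delta, S delta -> admissible delta (y0 delta).
  have /choice[y0 hy0] : forall delta, exists t, S delta -> admissible delta t.
    move=> delta; have [/exists_admissible[t ht]|nS] := pselect (S delta); first by exists t.
    by exists (fun=> 0).
  by exists y0.
apply: (omega1_rec hW (fun=> 0) (P := fun delta y t =>
    S delta -> admissible delta t /\ obstructs delta y (f delta) t)).
  move=> delta y y' t yy' h Sd; have [ht ob] := h Sd; split=> // h1 h2 x Ax xd hx.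
  have y'y mu : (mu < delta)%O -> y' mu = y mu by move=> /yy'.
  apply: (ob _ h2 x) => //.
  - move=> z Lz zd; have [h3 h4] := h1 z Lz zd; split=> //.
    exact: Aset_local h4 h3.
  - exact: Aset_local xd Ax.
  - move=> n; have [g [Ag gd E]] := hx n; exists g; split=> //.
    exact: Aset_local gd Ag.
move=> delta y IH; have [Sd|nS] := pselect (S delta); last by exists (fun=> 0).
(* Levels from [delta] on are filled with admissible sequences, as [bounded_denominators] speaks of
   sequences at all levels of [S]. *)
pose y' mu := if (mu < delta)%O then y mu else y0 mu.
have yy' mu : (mu < delta)%O -> y mu = y' mu by rewrite /y' => ->.
have hy' mu : S mu -> admissible mu (y' mu).
  by move=> Smu; rewrite /y'; case: ifP => [md|_]; [exact: (IH mu md Smu).1|exact: hy0].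
pose G x := Aset S p y' x /\ below_level delta x.
have [val|nval] := pselect ((forall x, lattice S x -> below_level delta x -> G (f delta x)) /\
    good delta (f delta)); last first.
  have [t ht] := exists_admissible Sd; exists t => _; split=> // h1 h2.
  case: nval; split=> // x Lx xd; have [h3 h4] := h1 x Lx xd; split=> //.
  exact: Aset_local h4 h3.
have [vG vg] := val.
have [|||t [ht tG]] := diagonal_sequence (G := G) Sd vg _ _ vG.
- by apply: sub_countable (countable_below_level hW delta); apply: subset_card_le => x [].
- by move=> x x' [h1 h2] [h1' h2']; split; [exact: AsetB|exact: below_levelB].
- move=> x x0; have [b bx] : exists b, coef b x != 0.
    apply: contrapT => no; move/eqP: x0; apply; apply: fsf_eqP => b; rewrite coef0.
    by apply/eqP; apply: contrapT => /negP h; apply: no; exists b.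
  (* With the least level as [alpha] the denominators of all coordinates are bounded. An element [g]
     with [p ^ n g = x] has the support of [x], so one [M] serves every [n]. *)
  have [z z0 nSz] := zero_notin_S hW hSlim.
  have [||||M hM] := @bounded_denominators _ W S hSlim p y' _ _ _ z (dom x).
  + by move=> mu j Smu; have [] := hy' mu Smu.
  + by move=> mu j Smu; have [] := hy' mu Smu.
  + by move=> mu nu Smu numu; have [_ _ h _] := hy' mu Smu; exact: h.
  + exact: nSz.
  have [n hn] := not_p_divisible M (prime_gt1 hp) bx.
  exists n => g [Ag _] E; have E' : p%:R ^+ n * coef b g = coef b x by rewrite -coefZ E.
  have := hn (coef b g); rewrite E' eqxx => h.
  suff : false by []. apply: h; apply: hM => // c _ cg.
  by rewrite mem_dom -E coefZ mulf_neq0 // expf_neq0 // pnatr_eq0 -lt0n prime_gt0.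
exists t => _; split=> // _ _ x Ax xd hx; apply: (tG x).
  by split=> //; exact: Aset_local xd Ax.
move=> n; have [g [Ag gd E]] := hx n; exists g => //; split=> //.
exact: Aset_local gd Ag.
Qed.

End Diagonal.

(** * Coherent systems *)

Section NoSystem.
Context (d : Order.disp_t) (W : orderType d) (hW : is_omega1 W).
Context (S : set W) (hSlim : forall a, S a -> is_limit a) (p : nat) (hp : prime p).
Local Notation B := (W * nat)%type.
Local Notation D := (fsf B).
Implicit Types (a mu nu delta : W).
Variable code : B -> W * B.
Hypothesis code_surj : forall nu mu (c : B), (c.1 <= mu)%O -> (mu <= nu)%O ->
  exists k, code (nu, k) = (mu, c).
Local Notation rho := (retract S code).
Variable y : W -> nat -> D.
Variable AA : zmodClosed D.
Hypothesis hAA : forall x, x \in AA <-> Aset S p y x.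
Local Notation A := (subgroup AA).

Lemma lattice_group (x : D) : lattice S x -> x \in AA.
Proof. by move=> Lx; apply/hAA/lattice_Aset. Qed.

Lemma exists_nonS_above (s : seq W) : exists2 nu, ~ S nu & forall mu, mu \in s -> (mu < nu)%O.
Proof.
have [c hc] := countable_bounded hW (finite_set_countable (finite_seq s)).
have [nu cnu] := exists_succ hW c; exists nu; first by move=> /hSlim; exact: succ_not_limit cnu.
by move=> mu /hc h; exact: lt_trans cnu.1.
Qed.

Section System.
Variables (I : Type) (pi : I -> {additive A -> A}) (H : I -> zmodClosed A).
Hypothesis sys : coherent_unbounded_system pi H.

Definition kills (s : seq W) i := forall x : A, lattice S (sgval x) ->
  (forall mu, mu \in s -> rho mu (sgval x) = 0) -> pi i x = 0.

Lemma kills_sub s s' i : {subset s <= s'} -> kills s i -> kills s' i.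
Proof. by move=> ss h x Lx kx; apply: h => // mu /ss; exact: kx. Qed.

Lemma kills_coherent s i j : [set` H j] `<=` [set` H i] -> kills s i -> kills s j.
Proof.
by move=> ji h x Lx kx; rewrite -(system_coherent sys ji) /= h // raddf0.
Qed.

(** Split [x] as [(x - w) + w], where [w] has the image of [x] under the retraction at [mu] and is
    killed by the others in question. Then [s] applies to [x - w] and [s'] to [w]. *)
Lemma kills_remove s s' mu i : mu \notin s' -> kills s i -> kills s' i ->
  kills [seq nu <- s | nu != mu] i.
Proof.
move=> ms' hs hs' x Lx kx.
have [nu nS hnu] := exists_nonS_above (mu :: s ++ s').
have [w [Lw rw kw]] := exists_shift code_surj (retract_lattice code mu Lx)
  (@retract_le _ _ S code mu (sgval x)) nS (hnu mu (mem_head _ _)).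
have above mu' : (mu' \in s) || (mu' \in s') -> (mu' < nu)%O.
  by move=> h; apply: hnu; rewrite inE mem_cat h orbT.
pose u : A := Subgroup (lattice_group Lw).
have u0 : pi i u = 0.
  apply: hs' => // mu' m'; apply: kw; last by apply: above; rewrite m' orbT.
  by apply: contraNneq ms' => <-.
have : pi i (x - u) = 0.
  apply: hs; first by rewrite sgvalB; exact: latticeB.
  move=> mu' m'; rewrite sgvalB retractB /=; have [->|mm] := eqVneq mu' mu.
    by rewrite rw subrr.
  rewrite kx ?mem_filter ?mm // kw ?subrr //.
  by apply: above; rewrite m'.
by rewrite raddfB u0 subr0.
Qed.

Lemma exists_upper (J : nat -> I) : exists k, forall n, [set` H (J n)] `<=` [set` H k].
Proof.
have [|k hk] := @system_unbounded _ _ _ _ sys (\bigcup_n [set` H (J n)]).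
  by apply: bigcup_countable => // n _; exact: (system_countable sys).
by exists k => n x xn; apply: hk; exists n.
Qed.

Lemma exists_unkilled : exists i, forall s, ~ kills s i.
Proof.
apply: contrapT => no.
have /choice[s hs] : forall i, exists s, [/\ uniq s, kills s i &
    forall s', kills s' i -> (size s <= size s')%N].
  move=> i; have ex : exists n, `[< exists2 s, kills s i & size s = n >].
    apply: contrapT => h; apply: no; exists i => s ks.
    by apply: h; exists (size s); apply/asboolP; exists s.
  have [n /asboolP[s ks sn] nmin] := find_ex_minn ex.
  have sub : {subset s <= undup s} by move=> x; rewrite mem_undup.
  exists (undup s); split; [exact: undup_uniq|exact: kills_sub ks|].
  move=> s' ks'; apply: leq_trans (size_undup s) _; rewrite sn; apply: nmin.
  by apply/asboolP; exists s'.
(* By coherence [s i] also kills at [j], so removing from [s j] an element outside [s i] would give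
   a smaller set for [j]. *)
have sub i j : [set` H j] `<=` [set` H i] -> {subset s j <= s i}.
  move=> ji mu mj; apply: contrapT => /negP mi; have [_ ki _] := hs i; have [_ kj jmin] := hs j.
  have := jmin _ (kills_remove mi kj (kills_coherent ji ki)).
  rewrite size_filter leqNgt -[X in (_ < X)%N](count_predT (s j)).
  by rewrite (count_lt (x := mu)) //= eqxx.
have ssize i j : [set` H j] `<=` [set` H i] -> (size (s j) <= size (s i))%N.
  by move=> /sub; apply: uniq_leq_size; have [] := hs j.
(* Otherwise there is a sequence of indices whose sets have unbounded sizes, and an index above all
   of them would need an infinite set. *)
have [i0 hi0] : exists i0, forall i, [set` H i0] `<=` [set` H i] -> (size (s i) <= size (s i0))%N.
  apply: contrapT => nomax.
  have /choice[f hf] : forall i, exists i', (size (s i) < size (s i'))%N.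
    move=> i; apply: contrapT => h; apply: nomax; exists i => i' _.
    by rewrite leqNgt; apply/negP => lt; apply: h; exists i'.
  have [i1 _] := @system_unbounded _ _ _ _ sys set0 (countable0 _).
  pose J n := iter n f i1.
  have Jsize n : (n <= size (s (J n)))%N.
    by elim: n => // n IH; apply: leq_ltn_trans IH (hf _).
  have [k hk] := exists_upper J.
  have := leq_trans (Jsize (size (s k)).+1) (ssize _ _ (hk _)).
  by rewrite ltnn.
have [nu nS hnu] := exists_nonS_above (s i0).
have [b bnu kb] := exists_killed code_surj nS.
have Lb : lattice S (unit b) by apply: lattice_unit; rewrite bnu.
pose x : A := Subgroup (lattice_group Lb).
have [k1 hk1] := @system_unbounded _ _ _ _ sys [set x] (countable1 x).
(* The index [k] is above [i0] and above an index whose image contains [x]; maximality makes [s k]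
   and [s i0] the same set, so [pi k] kills [x] although [x] is in its image. *)
have [k hk] := exists_upper (fun n => if n is 0%N then i0 else k1).
have i0k : [set` H i0] `<=` [set` H k] := hk 0%N.
have [us0 k0 _] := hs i0; have [usk kk _] := hs k.
have [_ skE] := uniq_min_size us0 (sub _ _ i0k) (hi0 _ i0k).
have k0k : kills (s i0) k by apply: kills_sub kk => mu; rewrite skE.
have x0 : pi k x = 0 by apply: k0k => //= mu /hnu; exact: kb.
have : range (pi k) x by rewrite (system_image sys); apply: (hk 1%N); exact: hk1.
move=> [z _ zx]; have := system_proj sys k z; rewrite /= zx x0 => /esym/(congr1 (fun u : A => coef b (sgval u))).
rewrite /= coef_unit eqxx coef0 => /eqP; by rewrite oner_eq0.
Qed.

End System.

(** * The guess by diamond and the contradiction *)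

Hypothesis y_lattice : forall delta j, S delta -> lattice S (y delta j).
Hypothesis y_below : forall delta j, S delta -> below_level delta (y delta j).
Variable F : W -> zmodClosed A.
Hypothesis hF : forall a (x : A), x \in F a <-> below_level a (sgval x).
Variable X : W -> set W.
Hypothesis hX : forall Y : set W, stationary [set delta | S delta /\ Y `&` below delta = X delta].
Variable kappa : B * D -> W.
Hypothesis kappa_inj : injective kappa.

(** [X delta] is read as the graph of a function, coded by [kappa]; where no value is coded the
    default is 0. *)
Definition guess_value delta (b : B) : D :=
  if pselect (exists x, X delta (kappa (b, x))) is left h then projT1 (cid h) else 0.

Definition guess delta : {linear D -> D} := lift (guess_value delta).

Hypothesis y_obstructs : forall delta, S delta ->
  obstructs S p code delta y (guess delta) (y delta).

Definition unitA (b : B) (nb : ~ S b.1) : A := Subgroup (lattice_group (lattice_unit nb)).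

(** At levels in [S] the value of [v] is [f 0], so that all values of [v] lie in the image of [f]
    and inherit its bound on levels. *)
Lemma additive_lift (f : {additive A -> A}) : exists v : B -> D,
  (forall b, exists u : A, v b = sgval (f u)) /\
  forall x : A, lattice S (sgval x) -> lift v (sgval x) = sgval (f x).
Proof.
have /choice[v hv] : forall b : B, exists z : D, (exists u : A, z = sgval (f u)) /\
    forall nb : ~ S b.1, z = sgval (f (unitA nb)).
  move=> b; have [Sb|nb] := pselect (S b.1).
    by exists (sgval (f 0)); split=> //; exists 0.
  exists (sgval (f (unitA nb))); split; first by exists (unitA nb).
  by move=> nb'; congr (sgval (f _)); exact: val_inj.
exists v; split=> [b|x Lx]; first exact: (hv b).1.
have [u ux] : exists2 u : A, sgval u = sgval x & lift v (sgval x) = sgval (f u).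
  apply: (lattice_ind (P := fun z => exists2 u : A, sgval u = z & lift v z = sgval (f u))) Lx.
  - by exists 0; rewrite ?raddf0.
  - move=> z z' [u <- hu] [u' <- hu']; exists (u - u') => //.
    by rewrite linearB [RHS]/= raddfB sgvalB; congr (_ - _).
  - by move=> b nb _; exists (unitA nb) => //; rewrite lift_unit (hv b).2.
by rewrite (val_inj ux).
Qed.

Lemma countable_pairs a : countable [set c : B * D | (c.1.1 < a)%O /\ below_level a c.2].
Proof. exact: countableX (countable_coordinates hW a) (countable_below_level hW a). Qed.

(* The values of pi i on the generators are guessed at some delta, whose y
   prevents pi i from being defined on the elements zgen delta n. *)
Lemma no_system : ~ has_coherent_unbounded_system A.
Proof.
move=> [I [pi [H sys]]]; have [i nk] := exists_unkilled sys.
set f := pi i in nk; have [v [vf hv]] := additive_lift f.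
(* The image of [pi i] is countable, so a single level bounds all its values. *)
have [a0 ha0] : exists a0, forall u : A, below_level a0 (sgval (f u)).
  have [a ha] := countable_sub_F hW hF (system_countable sys i).
  exists a => u; apply/hF/ha; rewrite -(system_image sys); by exists u.
have /choice[wit hwit] : forall s : seq W, exists u : A, [/\ lattice S (sgval u),
    forall mu, mu \in s -> rho mu (sgval u) = 0 & f u != 0].
  move=> s; apply: contrapT => no; apply: (nk s) => u Lu ku; apply/eqP.
  by apply: contrapT => /negP fu; apply: no; exists u.
have /choice[lv hlv] : forall s, exists a, below_level a (sgval (wit s)).
  by move=> s; exact: exists_below_level hW _.
(* A limit closed under [g] exceeds [a0], the codes of pairs bounded below it, and the level of a
   witness against each finite set of smaller levels. *)
have /choice[g hg] : forall c : W, exists e : W, [/\ (a0 < e)%O,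
    forall q : B * D, (q.1.1 < c)%O -> below_level c q.2 -> (kappa q < e)%O &
    forall s, (forall mu, mu \in s -> (mu < c)%O) -> (lv s < e)%O].
  move=> c.
  have [e1 he1] := countable_bounded hW
    (sub_countable (card_image_le kappa _) (countable_pairs c)).
  have [e2 he2] := countable_bounded hW
    (sub_countable (card_image_le lv _) (countable_seq (countable_below hW c))).
  have [e _ h] := exists_nonS_above [:: a0; e1; e2].
  exists e; split.
  - by apply: h; rewrite inE eqxx.
  - move=> q q1 q2; apply: lt_trans (he1 _ _) (h _ _); first by exists q.
    by rewrite !inE eqxx orbT.
  - move=> s sc; apply: lt_trans (he2 _ _) (h _ _); first by exists s.
    by rewrite !inE eqxx !orbT.
pose Y := [set kappa (b, v b) | b in [set b : B | ~ S b.1]].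
have [delta [[Sd Yd] [ld gd]]] := hX Y (closure_club hW g).
have va0 b : below_level a0 (v b) by have [u ->] := vf b.
have [c0 c0d] := limit_gt0 ld.
have a0d : (a0 < delta)%O by have [h _ _] := hg c0; exact: lt_trans h (gd _ c0d).
have gv b : ~ S b.1 -> (b.1 < delta)%O -> guess_value delta b = v b.
  move=> nb bd; have XE w : X delta w <-> Y w /\ (w < delta)%O by rewrite -Yd.
  rewrite /guess_value; case: pselect => [h|[]].
    by case: cid => z /= /XE[[b' _ /kappa_inj[<- <-]] _].
  exists (v b); apply/XE; split; first by exists b.
  have [c cd hc] : exists2 c, (c < delta)%O & forall mu, mu \in [:: a0; b.1] -> (mu < c)%O.
    apply: limit_seq_bounded => // mu; rewrite inE => /orP[/eqP->//|].
    by rewrite inE => /eqP->.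
  have [_ h _] := hg c; apply: lt_trans (h (b, v b) _ _) (gd _ cd) => /=.
    by apply: hc; rewrite !inE eqxx orbT.
  by apply: below_levelW (va0 b); apply/ltW/hc; rewrite inE eqxx.
have gE (u : A) : lattice S (sgval u) -> below_level delta (sgval u) ->
    guess delta (sgval u) = sgval (f u).
  move=> Lu ud; rewrite -hv //; apply: eq_lift => b bu.
  by apply: gv; [exact: (Lu b).2|exact: ud].
have fA u : Aset S p y (sgval (f u)) /\ below_level delta (sgval (f u)).
  split; first exact: group_inA hAA (f u).
  by apply: below_levelW (ha0 u); exact: ltW.
have valid x : lattice S x -> below_level delta x ->
    Aset S p y (guess delta x) /\ below_level delta (guess delta x).
  move=> Lx xd; have := gE (Subgroup (lattice_group Lx)) Lx xd; rewrite /= => ->.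
  exact: fA.
have gd' : good S code delta (guess delta).
  move=> s sd; have [c cd hc] := limit_seq_bounded ld sd.
  have [_ _ /(_ s hc) h] := hg c; have [h1 h2 h3] := hwit s.
  have wd : below_level delta (sgval (wit s)).
    by apply: below_levelW (hlv s); exact/ltW/(lt_trans h)/gd.
  exists (sgval (wit s)); split=> //; rewrite gE //.
pose z n := zgenA hp y_lattice hAA n Sd.
have [h1 h2] := fA (z 0%N).
(* By additivity the values of [pi i] at the [zgen delta n] satisfy exactly the equations that
   [y_obstructs] excludes. *)
apply: (y_obstructs Sd valid gd' h1 h2) => n; exists (sgval (f (z n))).
have [h3 h4] := fA (z n); split=> //.
have Le := eta_lattice p y_lattice n Sd.
have ed := eta_below (p := p) y_below Sd (n := n).
rewrite -/(eta p y n delta); have := gE (Subgroup (lattice_group Le)) Le ed; rewrite /= => ->.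
have pn (u : A) : sgval (u *+ p ^ n) = p%:R ^+ n *: sgval u.
  by rewrite -natrX scaler_nat -[LHS]/(sgval (u *~ (p ^ n)%N)) sgvalMz.
rewrite -pn -raddfMn -sgvalD -raddfD; congr (sgval (f _)); apply: val_inj.
rewrite [LHS]pn [RHS]sgvalD /= zgenE //; congr (_ + _).
by rewrite /zgen /eta big_geq // expr0 invr1 scale1r addr0.
Qed.

End NoSystem.

(** * Choice of the codings and assembly of the group *)

Theorem theorem3p1 (d : Order.disp_t) (W : orderType d) (hW : is_omega1 W)
    (S : set W) (hSlim : forall a : W, S a -> is_limit a)
    (hSstat : stationary S) (hdiamond : diamond S)
    (p : nat) (hp : prime p) :
  exists A : zmodType,
    [/\ aleph1_separable A,
        ([set: A] #= [set: W])%card,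
        Gamma W A = club_class S,
        has_quotient_type W A (Qp p)
      & ~ has_coherent_unbounded_system A].
Proof.
have [X [_ hX]] := hdiamond.
have [kappa kinj] : exists kappa : (W * nat) * fsf (W * nat)%type -> W, injective kappa.
  apply: (omega1_injection hW (countable_pairs hW)) => -[b x].
  have [a xa] := exists_below_level hW x; have [c hc] := exists_gt hW (Order.max a b.1).
  exists c; split=> /=; first by apply: le_lt_trans hc; rewrite le_max lexx orbT.
  by apply: below_levelW xa; apply/ltW/(le_lt_trans _ hc); rewrite le_max lexx.
(* For each [nu] there are countably many pairs of a level and a coordinate, both at most at level
   [nu]; the generators of level [nu] enumerate them. *)
have [code code_surj] : exists code : W * nat -> W * (W * nat), forall nu mu (c : W * nat),
    (c.1 <= mu)%O -> (mu <= nu)%O -> exists k, code (nu, k) = (mu, c).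
  have /choice[e he] : forall nu : W, exists e : nat -> W * (W * nat), forall mu (c : W * nat),
      (c.1 <= mu)%O -> (mu <= nu)%O -> exists k, e k = (mu, c).
    move=> nu; have [nu' snu] := exists_succ hW nu.
    pose Z := below nu' `*` [set b : W * nat | (b.1 < nu')%O].
    have cZ : countable Z.
      by apply: countableX; [exact: countable_below hW nu'|exact: countable_coordinates hW nu'].
    have Z0 : Z (nu, (nu, 0%N)) by split; exact: snu.1.
    have [e [_ he]] := countable_enum cZ Z0.
    exists e => mu c cmu munu; apply: he; split=> /=; rewrite /below /= (succ_lt _ snu) //.
    exact: le_trans munu.
  by exists (fun b => e b.1 b.2) => nu mu c h1 h2; exact: he.
have [y hy] := exists_obstructing hW hSlim hp code_surj (guess X kappa).
have y_lattice delta j : S delta -> lattice S (y delta j) by move=> /hy[[]].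
have y_below delta j : S delta -> below_level delta (y delta j) by move=> /hy[[]].
have y_fresh := fun delta nu (Sd : S delta) => let: And4 _ _ h _ := (hy delta Sd).1 in h nu.
have y_killed := fun delta mu (Sd : S delta) => let: And4 _ _ _ h := (hy delta Sd).1 in h mu.
have [AA hAA] := zmodClosed_of (@Aset0 _ W S p y) (@AsetB _ W S p y).
have /choice[F hF] : forall a : W, exists Fa : zmodClosed (subgroup AA),
    forall x, x \in Fa <-> below_level a (sgval x).
  move=> a; apply: zmodClosed_of; first exact: below_level0.
  by move=> u v hu hv; rewrite sgvalB; exact: below_levelB.
exists (subgroup AA); split.
- exact: (separable_A hW hSlim hp y_lattice y_below y_fresh y_killed hAA hF).
- exact: (card_A hW hp y_lattice hAA hF).
- exact: (Gamma_A hW hSlim hp y_lattice y_below y_fresh y_killed hAA hF).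
- exists F; first exact: (filtration_F hW hSlim hp y_lattice y_below y_fresh y_killed hAA hF).
  (* At [a] outside [S] the quotient is free, so only levels in [S] remain. *)
  move=> a b ab nf; apply: (quotient_F_Qp hp y_lattice y_below hAA hF) => //.
  apply: contrapT => nSa; apply: nf; apply: (free_quotient hW hSlim hp y_lattice y_below y_fresh hAA hF nSa) => //.
  exact: (countable_F hW hF).
- apply: (no_system hW hSlim hp code_surj hAA y_lattice y_below hF hX kinj).
  by move=> delta /hy[].
Qed.
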